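(* Assume that $\gamma=(x(\cdot),t(\cdot))$ is $C^1$ and that $t'(\tau)>0$ for every $\tau\in(0,T]$. Then the following dichotomy occurs: (i) either $u_\infty(x,t)<\infty$ for all $(x,t)\in Q_T$, (ii) or there exists $\tau_0\in(0,T]$ such that $$\limsup_{(x,t)\to(y,s)}u_\infty(x,t)=\infty\qquad\text{for all }(y,s)\in\Gamma\text{ with }0\le s\le\tau_0 .$$
   Context: Let $N\ge1$, $T>0$, $p>1$, $Q_T:=\mathbb{R}^N\times(0,T)$. Let $\Gamma=\{\gamma(\tau):=(x(\tau),t(\tau)):\tau\in[0,T]\}\subset\overline{Q_T}$ be a curve, where $\gamma:[0,T]\to\mathbb{R}^N\times[0,T]$ is Lipschitz and one-to-one, $\gamma(0)=(0,0)$ and $t(\tau)>0$ for $\tau\in(0,T]$. Let $h\in C(\overline{Q_T})$ satisfy $h=0$ on $\Gamma$ and $h>0$ on $\overline{Q_T}\setminus\Gamma$, and let $E(x,t)=(4\pi t)^{-N/2}e^{-|x|^2/4t}$ be the heat kernel. It is assumed that for every $R>0$ (with $B_R=\{x\in\mathbb{R}^N:|x|<R\}$) $$\int_0^T\int_{B_R}h(x,t)E^p(x,t)\,dx\,dt<\infty .$$ For $k>0$, $u_k$ denotes the unique nonnegative solution of $\partial_tu-\Delta u+h(x,t)u^p=0$ in $Q_T$ with $u_k(\cdot,0)=k\delta_0$, that is, $u_k\in C(\overline{Q_T}\setminus\{(0,0)\})\cap L^1(Q_T)$, $hu_k^p\in L^1(Q_T)$ and $$\iint_{Q_T}\left(-u_k\partial_t\zeta-u_k\Delta\zeta+hu_k^p\zeta\right)dx\,dt=k\,\zeta(0,0)$$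 for all compactly supported $\zeta\in C^{2,1}(\overline{Q_T})$ vanishing at $t=T$. The map $k\mapsto u_k$ is increasing, and $u_\infty:=\lim_{k\to\infty}u_k$ pointwise, with values in $[0,\infty]$. The limsup is taken over $(x,t)\in Q_T$. *)

(* Defs.v *)
From HB Require Import structures.
From mathcomp Require Import all_boot all_order all_algebra.
From mathcomp Require Import all_classical all_reals all_analysis.

Set Implicit Arguments.
Unset Strict Implicit.
Unset Printing Implicit Defensive.

Import Order.TTheory GRing.Theory Num.Theory.
Import numFieldNormedType.Exports.

Local Open Scope classical_set_scope.
Local Open Scope ring_scope.

(* The sigma-algebra on row vectors is the one generated by the coordinates
   (as the library does for tuples), i.e. the Borel sigma-algebra of R^n. *)
Definition measure_rV_display : measure_display.
Proof. exact: default_measure_display. Qed.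

Section measurable_rV.
Context {R : realType} (n : nat).

Let coors : 'I_n -> 'rV[R]_n -> measurableTypeR R := fun i x => x ord0 i.

Let rV_set0 : g_sigma_preimage coors set0.
Proof. exact: sigma_algebra0. Qed.

Let rV_setC A : g_sigma_preimage coors A -> g_sigma_preimage coors (~` A).
Proof. exact: sigma_algebraC. Qed.

Let rV_bigcup (F : _^nat) : (forall i, g_sigma_preimage coors (F i)) ->
  g_sigma_preimage coors (\bigcup_i (F i)).
Proof. exact: sigma_algebra_bigcup. Qed.

HB.instance Definition _ := @isMeasurable.Build measure_rV_display
  'rV[R]_n (g_sigma_preimage coors) rV_set0 rV_setC rV_bigcup.

End measurable_rV.

Section lebesgue_rV.
Context {R : realType}.

Lemma measurable_coord n (i : 'I_n) :
  measurable_fun [set: 'rV[R]_n]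
    (fun x : 'rV[R]_n => x ord0 i : measurableTypeR R).
Proof.
move=> _ Y mY; rewrite setTI; apply: sub_sigma_algebra => /=.
rewrite -bigcup_seq/=; exists i => /=; first by rewrite mem_index_enum.
by exists Y => //; rewrite setTI.
Qed.

Lemma measurable_fun_rV d (T : measurableType d) n (f : T -> 'rV[R]_n) :
  (forall i, measurable_fun setT (fun z => f z ord0 i : measurableTypeR R)) ->
  measurable_fun setT f.
Proof.
move=> mf; apply: measurability; first by [].
move=> _ [B + <-]; rewrite setTI -bigcup_seq/= => -[i _ [A mA <-]].
by rewrite setTI -[X in measurable X]setTI; exact: mf.
Qed.

Definition rV_cons n (z : measurableTypeR R * 'rV[R]_n) : 'rV[R]_n.+1 :=
  \row_i (if unlift ord0 i is Some j then z.2 ord0 j else z.1).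

Lemma measurable_rV_cons n : measurable_fun setT (@rV_cons n).
Proof.
apply: measurable_fun_rV => i; under eq_fun do rewrite mxE.
case: unliftP => [j _|_]; last exact: measurable_fst.
by apply: measurableT_comp (measurable_coord j) _; exact: measurable_snd.
Qed.

Section lebesgue_step.
Context n (mu : {sigma_finite_measure set 'rV[R]_n -> \bar R}).

Definition lebesgue_rV_step : set 'rV[R]_n.+1 -> \bar R :=
  pushforward (@lebesgue_measure R \x mu)%E (@rV_cons n).

Let mpre A : measurable A -> measurable (@rV_cons n @^-1` A).
Proof.
by move=> mA; rewrite -[X in measurable X]setTI; exact: measurable_rV_cons.
Qed.

Let step0 : lebesgue_rV_step set0 = 0%E.
Proof. by rewrite /lebesgue_rV_step /pushforward preimage_set0 measure0. Qed.

Let step_ge0 A : (0 <= lebesgue_rV_step A)%E.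
Proof. by rewrite /lebesgue_rV_step /pushforward; exact: measure_ge0. Qed.

Let step_sigma_additive : semi_sigma_additive lebesgue_rV_step.
Proof.
move=> F mF tF mUF; rewrite /lebesgue_rV_step /pushforward preimage_bigcup.
apply: measure_semi_sigma_additive => [i||].
- exact: mpre.
- apply/trivIsetP => /= i j _ _ ij; rewrite -preimage_setI.
  by move/trivIsetP : tF => /(_ _ _ _ _ ij) ->//; rewrite preimage_set0.
- by rewrite -preimage_bigcup; exact: mpre.
Qed.

HB.instance Definition _ := isMeasure.Build _ _ _ lebesgue_rV_step
  step0 step_ge0 step_sigma_additive.

Let step_sigma_finite : sigma_finite setT lebesgue_rV_step.
Proof.
have /sigma_finiteP[F [FT ndF Foo]] := sigma_finiteT (@lebesgue_measure R).
have /sigma_finiteP[G [GT ndG Goo]] := sigma_finiteT mu.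
pose g (x : 'rV[R]_n.+1) : measurableTypeR R * 'rV[R]_n :=
  (x ord0 ord0, \row_j x ord0 (lift ord0 j)).
have gK z : g (rV_cons z) = z.
  case: z => a x; rewrite /g mxE unlift_none /=; congr pair.
  by apply/rowP => j; rewrite !mxE liftK.
have mg : measurable_fun setT g.
  apply/measurable_fun_pairP; split; first exact: measurable_coord.
  apply: measurable_fun_rV => j; under eq_fun do rewrite /= mxE.
  exact: measurable_coord.
exists (fun i => g @^-1` (F i `*` G i)).
  apply/esym/seteqP; split => // x _.
  have : [set: measurableTypeR R] (g x).1 by [].
  have : [set: 'rV[R]_n] (g x).2 by [].
  rewrite FT GT => -[i _ Gi] [j _ Fj]; exists (maxn i j) => //=; split.
    by move: Fj; exact/subsetPset/ndF/leq_maxr.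
  by move: Gi; exact/subsetPset/ndG/leq_maxl.
move=> i; have [mFi Fi] := Foo i; have [mGi Gi] := Goo i; split.
  by rewrite -[X in measurable X]setTI; apply: mg => //; exact: measurableX.
rewrite /lebesgue_rV_step /pushforward -comp_preimage.
rewrite (_ : g \o _ = id); last exact/funext.
by rewrite preimage_id product_measure1E// lte_mul_pinfty// ge0_fin_numE.
Qed.

HB.instance Definition _ := Measure_isSigmaFinite.Build _ _ _ lebesgue_rV_step
  step_sigma_finite.
End lebesgue_step.

(* Lebesgue measure on R^n: a unit mass for n = 0, and the image of
   the product of the measures of R and R^n for n.+1. *)
Fixpoint lebesgue_rV n : {sigma_finite_measure set 'rV[R]_n -> \bar R} :=
  if n is n'.+1 then lebesgue_rV_step (lebesgue_rV n') else dirac (0 : 'rV[R]_0).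

Lemma lebesgue_rV_box n (A : 'I_n -> set (measurableTypeR R)) :
  (forall i, measurable (A i)) ->
  lebesgue_rV n [set x : 'rV[R]_n | forall i, A i (x ord0 i)] =
  (\prod_(i < n) lebesgue_measure (A i))%E.
Proof.
elim: n A => [A _|n IH A mA] /=.
  by rewrite big_ord0 diracE mem_set// => -[].
rewrite big_ord_recl -IH// /lebesgue_rV_step /pushforward.
rewrite -product_measure1E//.
  congr (_ _); apply/seteqP; split => [z /= Az|z /= [A0 AS] i].
    split; first by have := Az ord0; rewrite mxE unlift_none.
    by move=> i; have := Az (lift ord0 i); rewrite mxE liftK.
  by rewrite mxE; case: unliftP => [j ->|->].
set B := (X in measurable X).
have -> : B = \bigcap_(i in [set: 'I_n])
    ((fun x : 'rV[R]_n => x ord0 i) @^-1` A (lift ord0 i)).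
  by apply/seteqP; split => x /= h i; [move=> _|]; exact: h.
apply: fin_bigcap_measurable => // i _.
by rewrite -[X in measurable X]setTI; exact: measurable_coord.
Qed.

End lebesgue_rV.

Section heat_setting.
Context {R : realType} (N : nat).

(* Space-time R^N x R; a point is z = (x, t). *)
Local Notation X := ('rV[R]_N * R)%type.

Definition l2norm (x : 'rV[R]_N) : R := Num.sqrt (\sum_i x ord0 i ^+ 2).

Definition QT (T : R) : set X := [set z | 0 < z.2 < T].
Definition QTbar (T : R) : set X := [set z | 0 <= z.2 <= T].

Definition mu_xt : set ('rV[R]_N * measurableTypeR R) -> \bar R :=
  (lebesgue_rV N \x @lebesgue_measure R)%E.
HB.instance Definition _ := Measure.on mu_xt.

Definition heat_kernel (z : X) : R :=
  (4 * pi * z.2) `^ (- (N%:R / 2)) * expR (- (l2norm z.1 ^+ 2 / (4 * z.2))).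

Definition dir_x (i : 'I_N) : X := (delta_mx ord0 i, 0).
Definition dir_t : X := (0, 1).

Definition laplacian (f : X -> R) (z : X) : R :=
  \sum_(i < N) 'D_(dir_x i) ('D_(dir_x i) f) z.

Definition derivable_upto (T : R) (v : X) (f : X -> R) :=
  (forall z, QT T z -> derivable f z v) /\
  exists2 g : X -> R, {within QTbar T, continuous g} &
    forall z, QT T z -> 'D_v f z = g z.

(* C^{2,1} of the closed strip: f is continuous there, and its derivatives,
   which exist in the open strip, extend continuously to the closed one. *)
Definition C21 (T : R) (f : X -> R) :=
  [/\ {within QTbar T, continuous f},
      derivable_upto T dir_t f,
      forall i, derivable_upto T (dir_x i) f &
      forall i j, derivable_upto T (dir_x j) ('D_(dir_x i) f)].

Definition test_function (T : R) (zeta : X -> R) :=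
  [/\ C21 T zeta,
      compact (closure (QTbar T `&` [set z | zeta z != 0])) &
      forall x, zeta (x, T) = 0].

(* Values of u at the origin and outside the closed strip are irrelevant. *)
Definition is_solution (T p : R) (h : X -> R) (k : R) (u : X -> R) :=
  [/\ forall z, (QTbar T `\ 0) z -> 0 <= u z,
      {within QTbar T `\ 0, continuous u},
      mu_xt.-integrable (QT T) (EFin \o u),
      mu_xt.-integrable (QT T) (fun z => (h z * u z `^ p)%:E) &
      forall zeta, test_function T zeta ->
        (\int[mu_xt]_(z in QT T)
           (- u z * 'D_dir_t zeta z - u z * laplacian zeta z
            + h z * u z `^ p * zeta z)%:E = (k * zeta 0)%:E)%E].

Definition is_unique_solution (T p : R) (h : X -> R) (k : R) (u : X -> R) :=
  is_solution T p h k u /\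
  forall v, is_solution T p h k v -> forall z, (QTbar T `\ 0) z -> v z = u z.

Definition u_infty (u : R -> X -> R) (z : X) : \bar R :=
  lim ((u k z)%:E @[k --> +oo]).

End heat_setting.

(* f is C^1 on [a, b] with derivative df; at a and b it is one-sided. *)
Definition C1_with {R : realType} {V : normedModType R}
    (a b : R) (f df : R -> V) :=
  {within `[a, b], continuous df} /\
  forall s, s \in `[a, b] ->
    (r - s)^-1 *: (f r - f s) @[r --> within `[a, b] (s^')] --> df s.

(* Main.v *)
Require Import Defs.
From mathcomp Require Import all_boot all_order all_algebra.
From mathcomp Require Import all_classical all_reals all_analysis.
From mathcomp Require Import measurable_realfun.
From mathcomp Require Import ring lra.

(** The dichotomy rests on two facts about the solutions u_k that are uniform in k.

    Off the curve, where h > 0, the absorption term alone bounds them: near each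
    such point they are below one and the same constant, whatever their initial
    mass ([keller_osserman]). Everywhere, they are subsolutions of the heat
    equation, so that a bound on the parabolic boundary of a cylinder is a bound
    inside the cylinder.

    Suppose that u_infty is infinite at z0, at time t0. Then z0 is on the curve.
    Let z be a point of the curve at a time t1 with 0 < t1 < t0, and suppose that
    u_infty is bounded near z. As t' > 0, the curve meets the slice t = t1 at z
    only, so that by compactness the u_k are uniformly bounded on large balls of
    this slice. They are also uniformly bounded on the lateral boundary of a
    cylinder with this bottom that is wide enough to contain the curve. By the
    comparison with a constant they are uniformly bounded at z0, a contradiction.
    Hence the limsup of u_infty is infinite at every point of the curve at times
    in ]0, t0/2], and at the origin because these points accumulate there.

    Both facts are cases of one comparison with supersolutions,
    [comparison_principle]. Solutions are only continuous and the equation holds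
    in the sense of distributions, so they are averaged with a compactly supported
    mollifier (a product of one-dimensional bumps, which is an admissible test
    function). At a maximum of the average minus the supersolution, the difference
    quotient [heatq] of the operator Delta - d/dt is nonpositive; on the average it
    converges to the integral of u against the derivatives of the mollifier
    ([heatq_mollifier]), which the weak formulation identifies with the average of
    h u^p ([pairing_mollifier_heat]). The supersolutions are constants in one case
    and sums of negative powers of one-dimensional distances in the other. *)

Set Implicit Arguments.
Unset Strict Implicit.
Unset Printing Implicit Defensive.

Import Order.TTheory GRing.Theory Num.Theory.
Import numFieldNormedType.Exports.

Local Open Scope classical_set_scope.
Local Open Scope ring_scope.

(** * Difference quotients in one variable *)

Section one_variable.
Context {R : realType}.
Implicit Types (f : R -> R) (r s d e K L x y : R).

Lemma ler_MVT f (f1 : R -> R) x y K :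
  (forall t, `|t - y| <= `|x - y| -> is_derive t 1 f (f1 t)) ->
  (forall t, `|t - y| <= `|x - y| -> `|f1 t| <= K) ->
  `|f x - f y| <= K * `|x - y|.
Proof.
move=> df bK.
have main (a b : R) : a <= b ->
    (forall t, t \in `[a, b]%R -> is_derive t 1 f (f1 t)) ->
    (forall t, t \in `[a, b]%R -> `|f1 t| <= K) ->
    `|f b - f a| <= K * (b - a).
  move=> ab dab bab.
  have doo t : t \in `]a, b[%R -> is_derive t 1 f (f1 t).
    by move=> /subset_itv_oo_cc; exact: dab.
  have cf : {within `[a, b], continuous f}.
    apply: derivable_within_continuous => t /dab dt.
    exact: (@ex_derive _ _ _ _ _ _ _ dt).
  have [c cab ->] := MVT_segment ab doo cf.
  by rewrite normrM [X in _ * X]ger0_norm ?subr_ge0// ler_wpM2r ?subr_ge0// bab.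
have [xy|yx] := leP x y.
  rewrite distrC (distrC x y) [in X in _ <= X]ger0_norm ?subr_ge0//.
  have H t : t \in `[x, y]%R -> `|t - y| <= `|x - y|.
    rewrite in_itv/= => /andP[xt ty].
    by rewrite !ler0_norm ?subr_le0// lerN2 lerD2r.
  by apply: main => // t /H; [exact: df|exact: bK].
rewrite [in X in _ <= X]ger0_norm ?subr_ge0//; last exact: ltW.
have H t : t \in `[y, x]%R -> `|t - y| <= `|x - y|.
  rewrite in_itv/= => /andP[xt ty].
  by rewrite !ger0_norm ?subr_ge0// ?lerD2r// ltW.
by apply: main => [|t /H|t /H]; [exact: ltW|exact: df|exact: bK].
Qed.

(** The left-hand side, as a function of [s], vanishes to first order at 0, and its
    second derivative is the symmetric increment of [f2]: the mean value theorem
    is applied twice. *)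
Lemma second_difference f (f1 f2 : R -> R) r s K : 0 <= s ->
  (forall x, `|x - r| <= s -> is_derive x 1 f (f1 x)) ->
  (forall x, `|x - r| <= s -> is_derive x 1 f1 (f2 x)) ->
  (forall x, `|x - r| <= s -> `|f2 x - f2 r| <= K) ->
  `|f (r + s) + f (r - s) - 2 * f r - s ^+ 2 * f2 r| <= 2 * K * s ^+ 2.
Proof.
move=> s0 df df1 bK.
have Dp t : `|t - 0| <= s -> `|(r + t) - r| <= s by rewrite subr0 addrC addKr.
have Dm t : `|t - 0| <= s -> `|(r - t) - r| <= s.
  by rewrite subr0 [r - t]addrC addrK normrN.
pose g t := f (r + t) + f (r - t) - 2 * f r - t ^+ 2 * f2 r.
pose g1 t := f1 (r + t) - f1 (r - t) - 2 * t * f2 r.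
pose g2 t := f2 (r + t) + f2 (r - t) - 2 * f2 r.
have cmpp (k k1 : R -> R) t : is_derive (r + t) 1 k (k1 (r + t)) ->
    is_derive t 1 (fun t => k (r + t)) (k1 (r + t)).
  move=> dk; have -> : (fun t => k (r + t)) = k \o +%R r by [].
  by apply: is_derive_eq; rewrite add0r mulr1.
have cmpm (k k1 : R -> R) t : is_derive (r - t) 1 k (k1 (r - t)) ->
    is_derive t 1 (fun t => k (r - t)) (- k1 (r - t)).
  move=> dk; have -> : (fun t => k (r - t)) = k \o (fun t => r - t) by [].
  by apply: is_derive_eq; rewrite add0r mul1r mulrN1.
have dg (t : R) : `|t - 0| <= s -> is_derive t 1 g (g1 t).
  move=> ts; rewrite /g.
  have := cmpp f f1 t (df _ (Dp _ ts)).
  have := cmpm f f1 t (df _ (Dm _ ts)) => ? ?.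
  by apply: is_derive_eq; rewrite /g1 /GRing.scale/=; ring.
have dg1 (t : R) : `|t - 0| <= s -> is_derive t 1 g1 (g2 t).
  move=> ts; rewrite /g1.
  have := cmpp f1 f2 t (df1 _ (Dp _ ts)).
  have := cmpm f1 f2 t (df1 _ (Dm _ ts)) => ? ?.
  by apply: is_derive_eq; rewrite /g2 /GRing.scale/=; ring.
have s0' : `|s - 0| = s by rewrite subr0 ger0_norm.
have g0 : g 0 = 0 by rewrite /g addr0 subr0; ring.
have g10 : g1 0 = 0 by rewrite /g1 addr0 subr0; ring.
have bg2 (t : R) : `|t - 0| <= s -> `|g2 t| <= 2 * K.
  move=> ts; have -> : g2 t = (f2 (r + t) - f2 r) + (f2 (r - t) - f2 r).
    by rewrite /g2; ring.
  rewrite (le_trans (ler_normD _ _))// mulr2n mulrDl mul1r lerD//.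
    exact: bK (Dp _ ts).
  exact: bK (Dm _ ts).
have K0 : 0 <= 2 * K by apply: le_trans (bg2 0 _); rewrite // subrr normr0.
have bg1 (t : R) : `|t - 0| <= s -> `|g1 t| <= 2 * K * s.
  move=> ts; rewrite -[g1 t]subr0 -[X in _ - X]g10.
  rewrite (le_trans (@ler_MVT g1 g2 t 0 (2 * K) _ _))//.
  - by move=> x xt; apply: dg1; exact: le_trans xt ts.
  - by move=> x xt; apply: bg2; exact: le_trans xt ts.
  - by rewrite ler_wpM2l.
rewrite -/(g s) -[g s]subr0 -[X in _ - X]g0.
rewrite (le_trans (@ler_MVT g g1 s 0 (2 * K * s) _ _))// s0'//.
by rewrite expr2 mulrA.
Qed.

Lemma first_difference f (f1 : R -> R) r s K :
  (forall x, `|x - r| <= `|s| -> is_derive x 1 f (f1 x)) ->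
  (forall x, `|x - r| <= `|s| -> `|f1 x - f1 r| <= K) ->
  `|f (r + s) - f r - s * f1 r| <= K * `|s|.
Proof.
move=> df bK.
pose g t := f t - t * f1 r.
have -> : f (r + s) - f r - s * f1 r = g (r + s) - g r by rewrite /g; ring.
have rs : r + s - r = s by rewrite addrC addKr.
rewrite -[in leRHS]rs.
apply: (@ler_MVT g (fun t => f1 t - f1 r)); rewrite rs// => t ts.
have := df t ts => ?.
by rewrite /g; apply: is_derive_eq; rewrite /GRing.scale/=; ring.
Qed.

End one_variable.

(** * A twice differentiable bump function *)

Section bump.
Context {R : realType}.
Implicit Types (e r x y : R) (n : nat).

Lemma is_derive_cvg (V W : normedModType R) (f : V -> W) a v df :
  h^-1 *: (f (h *: v + a) - f a) @[h --> 0^'] --> df -> is_derive a v f df.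
Proof.
move=> fdf; apply: DeriveDef; first exact: cvgP fdf.
exact: cvg_lim fdf.
Qed.

Lemma is_derive_max0X n x :
  is_derive x 1 (fun x : R => Num.max 0 x ^+ n.+2) (n.+2%:R * Num.max 0 x ^+ n.+1).
Proof.
have [x0|x0|->] := ltgtP x 0.
- rewrite expr0n/= mulr0.
  apply: (@near_eq_is_derive _ _ _ (cst 0)).
    near=> y; rewrite /cst max_l ?expr0n//.
    by apply/ltW; near: y; exact: lt_nbhsl.
- apply: (@near_eq_is_derive _ _ _ (fun x => x ^+ n.+2)).
    by near=> y; rewrite max_r//; apply/ltW; near: y; exact: lt_nbhsr.
  have -> : (fun x : R => x ^+ n.+2) = id ^+ n.+2 by rewrite exprfctE.
  by apply: is_derive_eq; rewrite /GRing.scale/= mulr1.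
- rewrite expr0n/= mulr0; apply: is_derive_cvg.
  apply/cvgrPdist_le => eps eps0; near=> h.
  rewrite maxxx expr0n/= subr0 sub0r normrN /GRing.scale/= mulr1 addr0.
  have h0 : h != 0 by near: h; exact: nbhs_dnbhs_neq.
  have mh : `|Num.max 0 h| <= `|h|.
    have m0 : 0 <= Num.max 0 h by rewrite le_max lexx.
    by rewrite (ger0_norm m0) ge_max normr_ge0 ler_norm.
  have h1 : `|h| <= Num.min 1 eps.
    near: h; apply: nbhs_dnbhs; apply: (@nbhs0_le _ R^o).
    by rewrite lt_min ltr01.
  move: h1; rewrite le_min => /andP[h1 he].
  rewrite normrM normfV normrX ler_pdivrMl ?normr_gt0//.
  rewrite exprS exprS mulrA (@le_trans _ _ (`|h| * `|h|))//; last first.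
    by rewrite ler_wpM2l.
  rewrite -[leRHS]mulr1 ler_pM ?mulr_ge0//; first by rewrite ler_pM.
  by rewrite exprn_ile1// (le_trans mh).
Unshelve. all: by end_near. Qed.

Definition bump e n r : R := Num.max 0 (e ^+ 2 - r ^+ 2) ^+ n.

Lemma bump_ge0 e n r : 0 <= bump e n r.
Proof. by rewrite exprn_ge0// le_max lexx. Qed.

Lemma bump_eq0 e n r : 0 <= e <= `|r| -> bump e n.+1 r = 0.
Proof.
move=> /andP[e0 er]; rewrite /bump max_l ?expr0n// subr_le0.
by rewrite -(real_normK (num_real r)) lerXn2r ?nnegrE.
Qed.

Lemma bumpE e n r : 0 <= e -> `|r| <= e -> bump e n r = (e ^+ 2 - r ^+ 2) ^+ n.
Proof.
move=> e0 re; rewrite /bump max_r// subr_ge0.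
by rewrite -(real_normK (num_real r)) lerXn2r ?nnegrE.
Qed.

Lemma bump_le1 e n r : 0 <= e <= 1 -> bump e n r <= 1.
Proof.
move=> /andP[e0 e1]; rewrite exprn_ile1// ?le_max ?lexx// ge_max ler01/=.
by rewrite (@le_trans _ _ (e ^+ 2)) ?exprn_ile1// gerBl sqr_ge0.
Qed.

Lemma is_derive_bump e n r :
  is_derive r 1 (bump e n.+2) (n.+2%:R * (- 2 * r) * bump e n.+1 r).
Proof.
have -> : bump e n.+2 = (fun x : R => Num.max 0 x ^+ n.+2) \o (fun r => e ^+ 2 - r ^+ 2).
  by [].
have ? := is_derive_max0X n (e ^+ 2 - r ^+ 2).
by apply: is_derive_eq; rewrite /bump /GRing.scale/= ; ring.
Qed.

(** [dbump] and [ddbump] are the first two derivatives of [bump e 4]; 4 is the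
    least exponent for which [ddbump] is still differentiable at [e] and [- e],
    hence Lipschitz by the mean value theorem. *)
Definition dbump e r := - 8 * (r * bump e 3 r).
Definition ddbump e r := - 8 * bump e 3 r + 48 * (r ^+ 2 * bump e 2 r).

Lemma is_derive_bump4 e r : is_derive r 1 (bump e 4) (dbump e r).
Proof. by have ? := is_derive_bump e 2 r; apply: is_derive_eq; rewrite /dbump; ring. Qed.

Lemma is_derive_dbump e r : is_derive r 1 (dbump e) (ddbump e r).
Proof.
have ? := is_derive_bump e 1 r; apply: is_derive_eq.
have -> : bump e 3 r = (e ^+ 2 - r ^+ 2) * bump e 2 r.
  rewrite /bump; case: (leP 0 (e ^+ 2 - r ^+ 2)) => h; last by rewrite !expr0n mulr0.
  by rewrite exprS.
rewrite /ddbump /GRing.scale/= /bump.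
case: (leP 0 (e ^+ 2 - r ^+ 2)) => h; last by rewrite !expr0n/=; ring.
ring.
Qed.

Lemma norm_Xbump e k n r : 0 <= e <= 1 -> `|r ^+ k * bump e n.+1 r| <= 1.
Proof.
move=> /andP[e0 e1]; have [er|re] := leP e `|r|.
  by rewrite bump_eq0 ?e0// mulr0 normr0.
rewrite normrM normrX (ger0_norm (bump_ge0 _ _ _)) -[leRHS]mulr1.
apply: ler_pM; [by rewrite exprn_ge0|exact: bump_ge0| |by rewrite bump_le1 ?e0].
by rewrite exprn_ile1 ?(le_trans (ltW re)).
Qed.

(** A common bound for the first three derivatives of [bump e 4], locked so that
    it is never computed as a unary numeral. *)
Definition bumpC : R := locked 336.

Lemma bumpC_gt0 : 0 < bumpC.
Proof. by rewrite /bumpC -lock ltr0n. Qed.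

Lemma dbump_le e r : 0 <= e <= 1 -> `|dbump e r| <= bumpC.
Proof.
move=> e01; have := norm_Xbump 1 2 r e01; rewrite expr1 => H.
rewrite /bumpC -lock.
rewrite /dbump normrM normrN (ger0_norm (_ : 0 <= 8 :> R))//.
lra.
Qed.

Lemma ddbump_le e r : 0 <= e <= 1 -> `|ddbump e r| <= bumpC.
Proof.
move=> e01; have := norm_Xbump 0 2 r e01; rewrite expr0 mul1r.
have := norm_Xbump 2 1 r e01; rewrite /ddbump /bumpC -lock.
rewrite !ler_norml => /andP[? ?] /andP[? ?]; apply/andP; split; lra.
Qed.

Lemma bump4_lip e x y : 0 <= e <= 1 ->
  `|bump e 4 x - bump e 4 y| <= bumpC * `|x - y|.
Proof.
move=> e01; apply: (ler_MVT (f1 := dbump e)) => t _.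
  exact: is_derive_bump4.
exact: dbump_le.
Qed.

Lemma dbump_lip e x y : 0 <= e <= 1 ->
  `|dbump e x - dbump e y| <= bumpC * `|x - y|.
Proof.
move=> e01; apply: (ler_MVT (f1 := ddbump e)) => t _.
  exact: is_derive_dbump.
exact: ddbump_le.
Qed.

Lemma ddbump_lip e x y : 0 <= e <= 1 ->
  `|ddbump e x - ddbump e y| <= bumpC * `|x - y|.
Proof.
move=> e01.
pose d3 (r : R) := 144 * (r * bump e 2 r) - 192 * (r ^+ 3 * bump e 1 r).
apply: (@ler_MVT _ (ddbump e) d3) => t _; rewrite /d3.
  have ? := is_derive_bump e 1 t; have ? := is_derive_bump e 0 t.
  by apply: is_derive_eq; rewrite /GRing.scale/=; ring.
have := norm_Xbump 1 1 t e01; have := norm_Xbump 3 0 t e01; rewrite expr1 /bumpC -lock.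
by rewrite !ler_norml => /andP[? ?] /andP[? ?]; apply/andP; split; lra.
Qed.

Lemma dbump_eq0 e r : 0 <= e <= `|r| -> dbump e r = 0.
Proof. by move=> er; rewrite /dbump bump_eq0// !mulr0. Qed.

Lemma ddbump_eq0 e r : 0 <= e <= `|r| -> ddbump e r = 0.
Proof. by move=> er; rewrite /ddbump !bump_eq0// !mulr0 addr0. Qed.

(** The integral does not depend on the centre [a]: on its support the bump is a
    polynomial in [s - a], with an explicit antiderivative. *)
Lemma integral_bump e : 0 < e -> exists2 c : R, 0 < c &
  forall a, (\int[lebesgue_measure]_s (bump e 4 (s - a))%:E = c%:E)%E.
Proof.
move=> e0.
pose F (s : R) := e ^+ 8 * s - 4 / 3 * e ^+ 6 * s ^+ 3 + 6 / 5 * e ^+ 4 * s ^+ 5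
   - 4 / 7 * e ^+ 2 * s ^+ 7 + s ^+ 9 / 9.
have dF (s : R) : is_derive s 1 F ((e ^+ 2 - s ^+ 2) ^+ 4).
  by apply: is_derive_eq; rewrite /GRing.scale/=; field.
exists (F e - F (- e)).
  have -> : F e - F (- e) = 256 / 315 * e ^+ 9 by rewrite /F; field.
  by have := exprn_gt0 9 e0; lra.
move=> a; pose G s := F (s - a).
have dG (s : R) : is_derive s 1 G ((e ^+ 2 - (s - a) ^+ 2) ^+ 4).
  have -> : G = F \o (fun s => s - a) by [].
  have ? := dF (s - a).
  by apply: is_derive_eq; rewrite subr0 mulr1.
have cG : continuous G.
  move=> s; have := dG s => dGs; apply: differentiable_continuous.
  by apply/derivable1_diffP; exact: ex_derive.
transitivity (\int[lebesgue_measure]_(s in `[(a - e)%R, (a + e)%R]) (bump e 4 (s - a))%:E)%E.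
  rewrite [RHS]integral_mkcond; apply: eq_integral => s _.
  rewrite patchE; case: ifPn => // sN; congr EFin.
  rewrite bump_eq0// ltW//=; move: sN; rewrite notin_setE/= in_itv/= => /negP.
  rewrite negb_and -!ltNge => /orP[h|h].
    by rewrite distrC ler_normr; apply/orP; left; lra.
  by rewrite ler_normr; apply/orP; left; lra.
transitivity (\int[lebesgue_measure]_(s in `[(a - e)%R, (a + e)%R])
    ((e ^+ 2 - (s - a) ^+ 2) ^+ 4)%:E)%E.
  apply: eq_integral => s; rewrite inE/= in_itv/= => /andP[s1 s2].
  by rewrite bumpE ?(ltW e0)// ler_norml; apply/andP; split; lra.
rewrite (@continuous_FTC2 _ _ G); first 1 last.
- by lra.
- apply: continuous_subspaceT => s.
  apply: differentiable_continuous; apply/derivable1_diffP.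
  exact: ex_derive.
- split.
  + by move=> s _; have := dG s => dGs; exact: ex_derive.
  + exact/cvg_at_right_filter/cG.
  + exact/cvg_at_left_filter/cG.
- by move=> s _; have := dG s => dGs; rewrite derive1E derive_val.
by rewrite -EFinB /G; congr (F _ - F _)%:E; ring.
Qed.

End bump.

(** * Mollifiers in space-time *)

Section mollifier.
Context {R : realType} {N : nat}.
Local Notation X := ('rV[R]_N * R)%type.
Implicit Types (e s : R) (a z : X) (i : 'I_N) (n : 'I_N -> nat) (m k : nat).

(** The profile of the mollifier and its derivatives, indexed by their order so
    that a mixed partial derivative is given by a multi-index. *)
Definition profile e k : R -> R :=
  match k with 0 => bump e 4 | 1 => dbump e | _ => ddbump e end.

Definition mollifier e n m a z : R :=
  (\prod_i profile e (n i) (z.1 ord0 i - a.1 ord0 i)) * profile e m (z.2 - a.2).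

Definition incr i n : 'I_N -> nat := fun j => (n j + (j == i))%N.

Lemma is_derive_profile e k s : (k < 2)%N ->
  is_derive s 1 (profile e k) (profile e k.+1 s).
Proof.
by case: k => [|[|//]] _; [exact: is_derive_bump4|exact: is_derive_dbump].
Qed.

Lemma profile_lip e k s t : 0 <= e <= 1 ->
  `|profile e k s - profile e k t| <= bumpC * `|s - t|.
Proof.
by case: k => [|[|k]]; [exact: bump4_lip|exact: dbump_lip|exact: ddbump_lip].
Qed.

Lemma profile_le e k s : 0 <= e <= 1 -> `|profile e k s| <= bumpC.
Proof.
case: k => [|[|k]] e01; [|exact: dbump_le|exact: ddbump_le].
by have := norm_Xbump 0 3 s e01; rewrite expr0 mul1r => h; apply: le_trans h _; rewrite /bumpC -lock; lra.
Qed.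

Lemma profile0_le1 e s : 0 <= e <= 1 -> `|profile e 0 s| <= 1.
Proof. by move=> e01; have := norm_Xbump 0 3 s e01; rewrite expr0 mul1r. Qed.

Lemma profile_eq0 e k s : 0 <= e <= `|s| -> profile e k s = 0.
Proof.
by case: k => [|[|k]]; [exact: bump_eq0|exact: dbump_eq0|exact: ddbump_eq0].
Qed.

Lemma continuous_profile e k : 0 <= e <= 1 -> continuous (profile e k).
Proof.
move=> e01 s; apply/cvgrPdist_le => eps eps0; near=> t.
rewrite (le_trans (profile_lip _ _ _ e01))// mulrC -ler_pdivlMr ?bumpC_gt0//.
near: t; apply: cvgr_dist_le; first exact: cvg_id.
by rewrite divr_gt0 ?bumpC_gt0.
Unshelve. all: by end_near. Qed.

Lemma is_derive_to_cvg (V W : normedModType R) (f : V -> W) (a' v : V) df :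
  is_derive a' v f df -> h^-1 *: (f (h *: v + a') - f a') @[h --> 0^'] --> df.
Proof. by move=> [+ <-]. Qed.

Lemma is_derive_mollifier_x e n m a z i : (n i < 2)%N ->
  is_derive z (dir_x i) (mollifier e n m a) (mollifier e (incr i n) m a z).
Proof.
move=> ni; apply: is_derive_cvg.
pose C := (\prod_(j | j != i) profile e (n j) (z.1 ord0 j - a.1 ord0 j)) *
  profile e m (z.2 - a.2).
have -> : mollifier e (incr i n) m a z =
    profile e (n i).+1 (z.1 ord0 i - a.1 ord0 i) * C.
  rewrite /mollifier (bigD1 i)//= /incr eqxx addn1 /C mulrA; congr (_ * _ * _).
  by apply: eq_bigr => j /negPf ->; rewrite addn0.
have H := is_derive_to_cvg (is_derive_profile e (z.1 ord0 i - a.1 ord0 i) ni).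
rewrite (_ : (fun h => _) = (fun h => (h^-1 *: (profile e (n i) (h *: 1 +
  (z.1 ord0 i - a.1 ord0 i)) - profile e (n i) (z.1 ord0 i - a.1 ord0 i))) * C)).
  exact: (cvgM H (@cvg_cst _ C _ _ _)).
apply/funext => h /=.
rewrite /mollifier [in LHS](bigD1 i)//= [in X in _ *: (_ - X)](bigD1 i)//=.
rewrite !mxE eqxx /= /GRing.scale/= eqxx !mulr1 mulr0 add0r addrA.
rewrite [in LHS](eq_bigr (fun j => profile e (n j) (z.1 ord0 j - a.1 ord0 j))).
  by rewrite /C; ring.
by move=> j /negPf ji; rewrite !mxE ji andbF mulr0 add0r.
Qed.

Lemma is_derive_mollifier_t e n m a z : (m < 2)%N ->
  is_derive z (@dir_t R N) (mollifier e n m a) (mollifier e n m.+1 a z).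
Proof.
move=> m2; apply: is_derive_cvg.
have H := is_derive_to_cvg (is_derive_profile e (z.2 - a.2) m2).
pose C := \prod_i profile e (n i) (z.1 ord0 i - a.1 ord0 i).
rewrite (_ : (fun h => _) = (fun h => C * (h^-1 *: (profile e m (h *: 1 +
  (z.2 - a.2)) - profile e m (z.2 - a.2))))).
  exact: (cvgM (@cvg_cst _ C _ _ _) H).
apply/funext => h.
rewrite /mollifier /= scaler0 add0r /GRing.scale/= mulr1 addrA /C.
ring.
Qed.

Lemma continuous_coord i : continuous (fun z : X => z.1 ord0 i).
Proof.
move=> z; apply: (@cvg_comp _ _ _ fst (fun x : 'rV[R]_N => x ord0 i)).
  exact: cvg_fst.
exact: coord_continuous.
Qed.

Lemma continuous_mollifier e n m a : 0 <= e <= 1 -> continuous (mollifier e n m a).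
Proof.
move=> e01 z; apply: cvgM.
  apply: cvg_big => [|i _]; first exact: mul_continuous.
  apply: continuous_cvg; first exact: continuous_profile.
  by apply: cvgB; [exact: continuous_coord|exact: cvg_cst].
apply: continuous_cvg; first exact: continuous_profile.
by apply: cvgB; [exact: cvg_snd|exact: cvg_cst].
Qed.

Lemma mollifier_eq0 e n m a z : 0 <= e ->
  (exists i, e <= `|z.1 ord0 i - a.1 ord0 i|) \/ e <= `|z.2 - a.2| ->
  mollifier e n m a z = 0.
Proof.
move=> e0 [[i ei]|et]; rewrite /mollifier.
  by rewrite (bigD1 i)//= profile_eq0 ?mul0r// e0.
by rewrite [X in _ * X]profile_eq0 ?mulr0// e0.
Qed.

Lemma mollifier0_ge0 e a z : 0 <= mollifier e (fun=> 0%N) 0 a z.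
Proof. by rewrite mulr_ge0 ?prodr_ge0 //= => [i _|]; exact: bump_ge0. Qed.

Definition cylinder (x : 'rV[R]_N) (r t1 t2 : R) : set X :=
  [set z : X | (forall i, `|z.1 ord0 i - x ord0 i| <= r) /\ t1 <= z.2 <= t2].

Lemma cylinder_compact x r t1 t2 : compact (cylinder x r t1 t2).
Proof.
have -> : cylinder x r t1 t2 =
    [set y : 'rV[R]_N | forall i, `[x ord0 i - r, x ord0 i + r]%classic (y ord0 i)] `*`
    `[t1, t2]%classic.
  apply/seteqP; split=> z /= [zx zt]; split => //.
  - by move=> i; have := zx i; rewrite in_itv/= ler_distl.
  - by move=> i; have := zx i; rewrite in_itv/= ler_distl.
have cx := @rV_compact R N (fun i => `[x ord0 i - r, x ord0 i + r]%classic)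
  (fun i => @segment_compact R _ _).
exact: (compact_setX cx (@segment_compact R t1 t2)).
Qed.

Lemma cylinder_closed x r t1 t2 : closed (cylinder x r t1 t2).
Proof. by apply: compact_closed; [exact: norm_hausdorff|exact: cylinder_compact]. Qed.

(** All partial derivatives are mollifiers with another multi-index, hence
    continuous, and the support lies in a cylinder that ends before time [T]. *)
Lemma mollifier_test e T a : 0 < e <= 1 -> a.2 + e <= T ->
  test_function T (mollifier e (fun=> 0%N) 0 a).
Proof.
move=> /andP[e0 e1] aT.
have e01 : 0 <= e <= 1 by rewrite ltW.
have upto_t n m : (m < 2)%N -> derivable_upto T (@dir_t R N) (mollifier e n m a).
  move=> m2; split=> [z _|].
    have d := is_derive_mollifier_t e n a z m2; exact: ex_derive.
  exists (mollifier e n m.+1 a) => [|z _].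
    by apply: continuous_subspaceT; exact: continuous_mollifier.
  by have d := is_derive_mollifier_t e n a z m2; rewrite derive_val.
have upto_x n i : (n i < 2)%N -> derivable_upto T (dir_x i) (mollifier e n 0 a).
  move=> n2; split=> [z _|].
    have d := is_derive_mollifier_x e 0 a z n2; exact: ex_derive.
  exists (mollifier e (incr i n) 0 a) => [|z _].
    by apply: continuous_subspaceT; exact: continuous_mollifier.
  by have d := is_derive_mollifier_x e 0 a z n2; rewrite derive_val.
split.
- split.
  + by apply: continuous_subspaceT; exact: continuous_mollifier.
  + exact: upto_t.
  + by move=> i; exact: upto_x.
  + move=> i j.
    have -> : 'D_(dir_x i) (mollifier e (fun=> 0%N) 0 a) =
        mollifier e (incr i (fun=> 0%N)) 0 a.
      apply/funext => z.
      have d := @is_derive_mollifier_x e (fun=> 0%N) 0 a z i isT.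
      by rewrite derive_val.
    by apply: upto_x; rewrite /incr; case: (j == i).
- apply: (subclosed_compact _ (@cylinder_compact a.1 e (a.2 - e) (a.2 + e))).
    exact: closed_closure.
  have /closure_id -> := @cylinder_closed a.1 e (a.2 - e) (a.2 + e).
  apply: closure_subset => z [_ /= z0].
  have z1 i : `|z.1 ord0 i - a.1 ord0 i| <= e.
    rewrite leNgt; apply/negP => h; move/eqP: z0; apply.
    by apply: mollifier_eq0; [exact: ltW|left; exists i; exact: ltW].
  have z2 : `|z.2 - a.2| <= e.
    rewrite leNgt; apply/negP => h; move/eqP: z0; apply.
    by apply: mollifier_eq0; [exact: ltW|right; exact: ltW].
  split; first exact: z1.
  by rewrite -ler_distl.
- move=> x; apply: mollifier_eq0; first exact: ltW.
  by right => /=; rewrite ler_normr; apply/orP; left; lra.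
Qed.

Lemma derive_mollifier_t e a z :
  'D_(@dir_t R N) (mollifier e (fun=> 0%N) 0 a) z = mollifier e (fun=> 0%N) 1 a z.
Proof.
by have d := @is_derive_mollifier_t e (fun=> 0%N) 0 a z isT; rewrite derive_val.
Qed.

Lemma laplacian_mollifier e a z :
  laplacian (mollifier e (fun=> 0%N) 0 a) z =
  \sum_i mollifier e (incr i (incr i (fun=> 0%N))) 0 a z.
Proof.
rewrite /laplacian; apply: eq_bigr => i _.
have -> : 'D_(dir_x i) (mollifier e (fun=> 0%N) 0 a) =
    mollifier e (incr i (fun=> 0%N)) 0 a.
  apply/funext => y.
  have d := @is_derive_mollifier_x e (fun=> 0%N) 0 a y i isT.
  by rewrite derive_val.
have n1 : (incr i (fun=> 0) i < 2)%N by rewrite /incr eqxx.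
by have d := is_derive_mollifier_x e 0 a z n1; rewrite derive_val.
Qed.

End mollifier.

(** * The mass of a mollifier *)

Section integrals.
Context {R : realType}.

Lemma measurable_coord_prod n (f : 'I_n -> R -> R) :
  (forall i, measurable_fun setT (f i)) ->
  measurable_fun setT (fun x : 'rV[R]_n => \prod_i f i (x ord0 i)).
Proof.
move=> mf; apply: measurable_prod => i _.
exact: (measurableT_comp (mf i) (@measurable_coord R n i)).
Qed.

(** Tonelli's theorem, one coordinate at a time. *)
Lemma integral_coord_prod n (f : 'I_n -> R -> R) (c : 'I_n -> R) :
  (forall i, measurable_fun setT (f i)) -> (forall i s, 0 <= f i s) ->
  (forall i, \int[lebesgue_measure]_s (f i s)%:E = (c i)%:E)%E ->
  (\int[lebesgue_rV n]_x (\prod_i f i (x ord0 i))%:E = (\prod_i c i)%:E)%E.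
Proof.
elim: n f c => [|n IH] f c mf f0 fc.
  rewrite /= integral_dirac//; last by apply/measurable_EFinP; exact: measurable_coord_prod.
  by rewrite diracT mul1e !big_ord0.
have c0 i : 0 <= c i.
  by rewrite -lee_fin -fc; apply: integral_ge0 => s _; rewrite lee_fin.
pose F (x : 'rV[R]_n.+1) := (\prod_i f i (x ord0 i))%:E.
have mF : measurable_fun setT F.
  by apply/measurable_EFinP; exact: measurable_coord_prod.
have -> : (\int[lebesgue_rV n.+1]_x F x =
    \int[lebesgue_measure \x lebesgue_rV n]_z F (rV_cons z))%E.
  have := @ge0_integral_pushforward _ _ _ _ R (@rV_cons R n)
    (@measurable_rV_cons R n) (lebesgue_measure \x lebesgue_rV n)%E setT F
    measurableT mF.
  rewrite preimage_setT; apply=> x _.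
  by rewrite lee_fin prodr_ge0.
pose G (x : 'rV[R]_n) := \prod_(i < n) f (lift ord0 i) (x ord0 i).
have FE s x : F (rV_cons (s, x)) = ((f ord0 s)%:E * (G x)%:E)%E.
  rewrite /F big_ord_recl -EFinM !mxE unlift_none /=; congr (_ * _)%:E.
  by apply: eq_bigr => i _; rewrite mxE liftK.
have mG : measurable_fun setT (EFin \o G).
  by apply/measurable_EFinP; exact: (measurable_coord_prod (fun i => mf (lift ord0 i))).
have IG := IH (fun i => f (lift ord0 i)) (fun i => c (lift ord0 i))
  (fun i => mf _) (fun i => f0 _) (fun i => fc _).
rewrite fubini_tonelli1//=; last 2 first.
- exact: measurableT_comp mF (@measurable_rV_cons R n).
- by move=> z; rewrite lee_fin prodr_ge0.
rewrite /fubini_F.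
under eq_integral do under eq_integral do rewrite FE.
under eq_integral => s _.
  rewrite ge0_integralZl_EFin//; last by move=> x _; rewrite lee_fin prodr_ge0.
  rewrite IG muleC; over.
rewrite ge0_integralZl_EFin//; last 3 first.
- by move=> s _; rewrite lee_fin.
- by apply/measurable_EFinP; exact: mf.
- by rewrite prodr_ge0.
by rewrite fc -EFinM big_ord_recl mulrC.
Qed.

Context {N : nat}.
Local Notation X := ('rV[R]_N * R)%type.

Lemma measurable_mollifier (e : R) (n : 'I_N -> nat) m (a : X) : 0 <= e <= 1 ->
  measurable_fun setT (mollifier e n m a : 'rV[R]_N * measurableTypeR R -> R).
Proof.
move=> e01.
have mp k (b : R) : measurable_fun setT (fun s : R => profile e k (s - b)).
  apply: continuous_measurable_fun => s.
  apply: continuous_cvg; first exact: continuous_profile.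
  by apply: cvgB; [exact: cvg_id|exact: cvg_cst].
apply: measurable_funM.
  have mP := @measurable_coord_prod N
    (fun i s => profile e (n i) (s - a.1 ord0 i)) (fun i => mp _ _).
  exact: (measurableT_comp mP measurable_fst).
exact: (measurableT_comp (mp _ _) measurable_snd).
Qed.

(** Since the total mass [c] is the same for every centre, dividing by it commutes
    with difference quotients in the centre. *)
Lemma integral_mollifier (e : R) : 0 < e <= 1 -> exists2 c : R, 0 < c &
  forall a : X, (\int[@mu_xt R N]_z (mollifier e (fun=> 0%N) 0 a z)%:E = c%:E)%E.
Proof.
move=> /andP[e0 e1]; have [c c0 cE] := integral_bump e0.
have e01 : 0 <= e <= 1 by rewrite ltW.
exists (c * \prod_(i < N) c) => [|a]; first by rewrite mulr_gt0// prodr_gt0.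
have mp (b : R) : measurable_fun setT (fun s : R => bump e 4 (s - b)).
  apply: continuous_measurable_fun => s.
  apply: continuous_cvg; first exact: (@continuous_profile _ _ 0).
  by apply: cvgB; [exact: cvg_id|exact: cvg_cst].
rewrite /mu_xt fubini_tonelli1//=; last 2 first.
- by apply/measurable_EFinP; exact: measurable_mollifier.
- by move=> z; rewrite lee_fin mollifier0_ge0.
rewrite /fubini_F.
pose f i (s : R) := bump e 4 (s - a.1 ord0 i).
have f0 (i : 'I_N) s : 0 <= f i s by exact: bump_ge0.
have mf (i : 'I_N) : measurable_fun setT (f i) by exact: mp.
under eq_integral => x _.
  under eq_integral do rewrite /mollifier/= EFinM.
  rewrite ge0_integralZl_EFin//; last 3 first.
  - by move=> s _; rewrite lee_fin bump_ge0.
  - by apply/measurable_EFinP; exact: mp.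
  - by rewrite prodr_ge0// => i _; exact: bump_ge0.
  rewrite cE muleC; over.
rewrite ge0_integralZl_EFin//; last 3 first.
- by move=> x _; rewrite lee_fin prodr_ge0// => i _; exact: bump_ge0.
- by apply/measurable_EFinP; exact: (measurable_coord_prod mf).
- exact: ltW.
rewrite EFinM; congr (_ * _)%E.
exact: (@integral_coord_prod N f (fun=> c) mf f0 (fun i => cE (a.1 ord0 i))).
Qed.

End integrals.

(** * Difference quotients of the heat operator *)

Section pairing.
Context d (T : measurableType d) (R : realType) (mu : {measure set T -> \bar R}).
Variables (D : set T) (mD : measurable D) (u : T -> R).
Hypothesis iu : mu.-integrable D (EFin \o u).
Implicit Types f g : T -> R.

Definition bounded_measurable f :=
  measurable_fun setT f /\ exists M, forall x, `|f x| <= M.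

Definition pairing f : R := \int[mu]_(x in D) (u x * f x).

Lemma bounded_measurableD f g : bounded_measurable f -> bounded_measurable g ->
  bounded_measurable (fun x => f x + g x).
Proof.
move=> [mf [M fM]] [mg [M' gM]]; split; first exact: measurable_funD.
by exists (M + M') => x; rewrite (le_trans (ler_normD _ _))// lerD.
Qed.

Lemma bounded_measurableZ f k : bounded_measurable f ->
  bounded_measurable (fun x => k * f x).
Proof.
move=> [mf [M fM]]; split; first exact: measurable_funM.
by exists (`|k| * M) => x; rewrite normrM ler_wpM2l.
Qed.

Lemma bounded_measurable_sum I (s : seq I) (f : I -> T -> R) :
  (forall i, bounded_measurable (f i)) ->
  bounded_measurable (fun x => \sum_(i <- s) f i x).
Proof.
move=> bf; elim: s => [|i s IH].
  split; first by under eq_fun do rewrite big_nil; exact: measurable_cst.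
  by exists 0 => x; rewrite big_nil normr0.
by under eq_fun do rewrite big_cons; exact: bounded_measurableD.
Qed.

Lemma integrable_pairing f : bounded_measurable f ->
  mu.-integrable D (EFin \o (fun x => u x * f x)).
Proof.
move=> [mf [M fM]].
apply: (integrableMl mD iu (measurable_funTS mf)).
exists M; split; first exact: num_real.
by move=> x Mx y _; apply: (le_trans (fM y)); exact: ltW.
Qed.

Lemma pairingD f g : bounded_measurable f -> bounded_measurable g ->
  pairing (fun x => f x + g x) = pairing f + pairing g.
Proof.
move=> bf bg; rewrite /pairing -RintegralD//; try exact: integrable_pairing.
by apply: eq_Rintegral => x _; rewrite mulrDr.
Qed.

Lemma pairingZ f k : bounded_measurable f -> pairing (fun x => k * f x) = k * pairing f.
Proof.
move=> bf; rewrite /pairing -RintegralZl//; last exact: integrable_pairing.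
by apply: eq_Rintegral => x _; rewrite mulrCA.
Qed.

Lemma pairingN f : bounded_measurable f -> pairing (fun x => - f x) = - pairing f.
Proof.
move=> bf; rewrite -mulN1r -pairingZ//; congr pairing.
by apply/funext => x; rewrite mulN1r.
Qed.

Lemma pairing_sum I (s : seq I) (f : I -> T -> R) :
  (forall i, bounded_measurable (f i)) ->
  pairing (fun x => \sum_(i <- s) f i x) = \sum_(i <- s) pairing (f i).
Proof.
move=> bf; elim: s => [|i s IH].
  rewrite big_nil -[RHS](mul0r (pairing (cst 0))) -pairingZ.
    by congr pairing; apply/funext => x; rewrite big_nil mul0r.
  by split; [exact: measurable_cst|exists 0 => x; rewrite normr0].
rewrite big_cons -IH -pairingD//; last exact: bounded_measurable_sum.
by congr pairing; apply/funext => x; rewrite big_cons.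
Qed.

Lemma pairing_le f K : bounded_measurable f -> (forall x, D x -> `|f x| <= K) ->
  `|pairing f| <= K * \int[mu]_(x in D) `|u x|.
Proof.
move=> bf fK.
have iau : mu.-integrable D (EFin \o (fun x => `|u x|)) by exact: integrable_norm.
rewrite (le_trans (le_normr_Rintegral mD (integrable_pairing bf)))//.
rewrite -RintegralZl//; apply: le_Rintegral => //.
- by apply: integrable_norm; exact: integrable_pairing.
- rewrite (_ : _ \o _ = (fun x => K%:E * (`|u x|%R)%:E)%E).
    exact: (integrableZl mD K iau).
  by apply/funext => x /=; rewrite EFinM.
- by move=> x Dx; rewrite normrM mulrC ler_wpM2r// fK.
Qed.

End pairing.

Section difference_quotients.
Context {R : realType} {N : nat}.
Local Notation X := ('rV[R]_N * R)%type.
Implicit Types (e s : R) (a z : X) (v w : X -> R).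

(** The difference quotient of the operator Delta - d/dt, with a backward
    difference in time, so that it is nonpositive at a maximum even on the top
    of a cylinder. *)
Definition heatq s v z : R :=
  \sum_(i < N) s ^- 2 * (v (z + s *: dir_x i) + v (z - s *: dir_x i) - 2 * v z)
  - s^-1 * (v z - v (z - s *: @dir_t R N)).

Lemma heatqB s v w z : heatq s (fun z => v z - w z) z = heatq s v z - heatq s w z.
Proof.
rewrite /heatq; set S1 := \sum_(i < N) _; set S2 := \sum_(i < N) _.
set S3 := \sum_(i < N) _.
have -> : S1 = S2 - S3 by rewrite -sumrB; apply: eq_bigr => i _; ring.
ring.
Qed.

Lemma heatqZ s k v z : heatq s (fun z => k * v z) z = k * heatq s v z.
Proof.
rewrite /heatq [RHS]mulrBr mulr_sumr; congr (_ - _); last by ring.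
by apply: eq_bigr => i _; ring.
Qed.

Lemma heatq_time s t1 z : 0 < s -> heatq s (fun z => z.2 - t1) z = - 1.
Proof.
move=> s0; rewrite /heatq big1 => [|i _] /=.
  by rewrite /GRing.scale/=; field; exact: lt0r_neq0.
by rewrite scaler0 addr0 subr0; ring.
Qed.

(** (Delta + d/dt) of the mollifier in its argument. It is also the limit of the
    quotients [heatq] in the centre: the mollifier depends on the difference of
    its argument and its centre, so d/dt changes sign and Delta does not. *)
Definition mollifier_heat e a z : R :=
  \sum_i mollifier e (incr i (incr i (fun=> 0%N))) 0 a z + mollifier e (fun=> 0%N) 1 a z.

Lemma norm_prod_le1 (I : Type) (r : seq I) (P : pred I) (F : I -> R) :
  (forall i, `|F i| <= 1) -> `|\prod_(i <- r | P i) F i| <= 1.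
Proof.
move=> F1; elim/big_rec: _ => [|i x _ x1]; first by rewrite normr1.
by rewrite normrM mulr_ile1.
Qed.

(** Each term varies one factor of the product only, and the other factors are
    bounded by 1. *)
Lemma heatq_mollifier e a z s : 0 <= e <= 1 -> 0 < s ->
  `|heatq s (fun a => mollifier e (fun=> 0%N) 0 a z) a - mollifier_heat e a z|
    <= (2 * bumpC * N%:R + bumpC) * s.
Proof.
move=> e01 s0; rewrite /heatq /mollifier_heat.
have s0' : s != 0 by exact: lt0r_neq0.
set S1 := \sum_(i < N) _; set S2 := \sum_(i < N) _.
set d := s^-1 * _; set m := mollifier _ _ 1 _ _.
have -> : S1 - d - (S2 + m) = (S1 - S2) - (d + m) by ring.
rewrite (le_trans (ler_normB _ _))// mulrDl lerD//.
  rewrite /S1 /S2 -sumrB (le_trans (ler_norm_sum _ _ _))//.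
  rewrite (@le_trans _ _ (\sum_(i < N) (2 * bumpC * s)))//; last first.
    by rewrite sumr_const card_ord -[_ *+ N]mulr_natr mulrAC.
  apply: ler_sum => i _.
  pose C := (\prod_(j | j != i) profile e 0 (z.1 ord0 j - a.1 ord0 j)) *
    profile e 0 (z.2 - a.2).
  have C1 : `|C| <= 1.
    by rewrite normrM mulr_ile1 ?profile0_le1// norm_prod_le1// => j; exact: profile0_le1.
  have mE (h : R) : mollifier e (fun=> 0%N) 0 (a + h *: dir_x i) z =
      profile e 0 (z.1 ord0 i - a.1 ord0 i - h) * C.
    rewrite /mollifier (bigD1 i)//= /C mulrA; congr (_ * _ * _).
    - by rewrite !mxE !eqxx/= mulr1 opprD addrA.
    - by apply: eq_bigr => j /negPf ji; rewrite !mxE ji andbF mulr0 addr0.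
    - by rewrite scaler0 addr0.
  have m0 : mollifier e (fun=> 0%N) 0 a z = profile e 0 (z.1 ord0 i - a.1 ord0 i) * C.
    by have := mE 0; rewrite scale0r addr0 subr0.
  have m2 : mollifier e (incr i (incr i (fun=> 0%N))) 0 a z =
      profile e 2 (z.1 ord0 i - a.1 ord0 i) * C.
    rewrite /mollifier (bigD1 i)//= /C mulrA; congr (_ * _ * _).
      by rewrite /incr eqxx.
    by apply: eq_bigr => j /negPf ji; rewrite /incr ji.
  rewrite -scaleNr !mE opprK m0 m2.
  set r := z.1 ord0 i - a.1 ord0 i.
  have -> : s ^- 2 * (profile e 0 (r - s) * C + profile e 0 (r + s) * C -
      2 * (profile e 0 r * C)) - profile e 2 r * C =
    s ^- 2 * C * (profile e 0 (r + s) + profile e 0 (r - s) - 2 * profile e 0 r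
      - s ^+ 2 * profile e 2 r) by field.
  rewrite normrM normrM normfV normrX (gtr0_norm s0) -mulrA ler_pdivrMl ?exprn_gt0//.
  rewrite -[leRHS]mul1r ler_pM//.
  have := @second_difference R (profile e 0) (profile e 1) (profile e 2) r s
    (bumpC * s) (ltW s0) (fun x _ => @is_derive_profile R e 0 x isT)
    (fun x _ => @is_derive_profile R e 1 x isT).
  rewrite [2 * (bumpC * s) * _](_ : _ = s ^+ 2 * (2 * bumpC * s)); last by ring.
  apply=> x xs; rewrite (le_trans (profile_lip _ _ _ e01))//.
  by rewrite ler_wpM2l// ltW// bumpC_gt0.
pose C := \prod_j profile e 0 (z.1 ord0 j - a.1 ord0 j).
have C1 : `|C| <= 1 by rewrite norm_prod_le1// => j; exact: profile0_le1.
have mE (h : R) : mollifier e (fun=> 0%N) 0 (a - h *: @dir_t R N) z =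
    C * profile e 0 (z.2 - a.2 + h).
  rewrite /mollifier /C; congr (_ * _).
    by apply: eq_bigr => j _; rewrite /= scaler0 subr0.
  by rewrite /= /GRing.scale/= mulr1 opprB addrA addrAC.
have m0 : mollifier e (fun=> 0%N) 0 a z = C * profile e 0 (z.2 - a.2).
  by have := mE 0; rewrite scale0r subr0 addr0.
rewrite /d /m mE m0.
set r := z.2 - a.2.
have -> : s^-1 * (C * profile e 0 r - C * profile e 0 (r + s)) +
    mollifier e (fun=> 0%N) 1 a z =
  - (s^-1 * C * (profile e 0 (r + s) - profile e 0 r - s * profile e 1 r)).
  by rewrite /mollifier -/C -/r; field.
rewrite normrN normrM normrM normfV (gtr0_norm s0) -mulrA ler_pdivrMl//.
rewrite -[leRHS]mul1r ler_pM//.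
have := @first_difference R (profile e 0) (profile e 1) r s (bumpC * s)
  (fun x _ => @is_derive_profile R e 0 x isT).
rewrite (gtr0_norm s0) [bumpC * s * s]mulrC.
apply=> x xs; rewrite (le_trans (profile_lip _ _ _ e01))//.
by rewrite ler_wpM2l ?(ltW bumpC_gt0).
Qed.

(** Telescoping product. *)
Lemma norm_prodB (I : Type) (r : seq I) (F G : I -> R) :
  (forall i, `|F i| <= 1) -> (forall i, `|G i| <= 1) ->
  `|\prod_(i <- r) F i - \prod_(i <- r) G i| <= \sum_(i <- r) `|F i - G i|.
Proof.
move=> F1 G1; elim: r => [|i r IH]; first by rewrite !big_nil subrr normr0.
rewrite !big_cons.
set P := \prod_(j <- r) F j; set Q := \prod_(j <- r) G j.
have -> : F i * P - G i * Q = (F i - G i) * P + G i * (P - Q) by ring.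
rewrite (le_trans (ler_normD _ _))// !normrM lerD//.
  by rewrite ler_piMr//; exact: norm_prod_le1.
by rewrite (le_trans _ IH)// ler_piMl.
Qed.

Lemma norm_coord (x : 'rV[R]_N) i : `|x ord0 i| <= `|x|.
Proof.
rewrite [leRHS]/Num.Def.normr/= mx_normrE.
exact: (le_bigmax _ (fun ij : 'I_1 * 'I_N => `|x ij.1 ij.2|) (ord0, i)).
Qed.

Lemma norm_coordB (a a' : X) i : `|a.1 ord0 i - a'.1 ord0 i| <= `|a - a'|.
Proof.
have := norm_coord (a.1 - a'.1) i; rewrite !mxE => h; apply: le_trans h _.
by rewrite prod_normE le_max lexx.
Qed.

Lemma norm_timeB (a a' : X) : `|a.2 - a'.2| <= `|a - a'|.
Proof. by rewrite prod_normE le_max lexx orbT. Qed.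

(** Uniformity in [z] makes the mollification a continuous function of the
    centre, so that it attains a maximum on compact sets. *)
Lemma mollifier_lip e a a' z : 0 <= e <= 1 ->
  `|mollifier e (fun=> 0%N) 0 a z - mollifier e (fun=> 0%N) 0 a' z|
    <= bumpC * N.+1%:R * `|a - a'|.
Proof.
move=> e01; rewrite /mollifier.
set P := \prod_i _; set Q := \prod_i _; set p := profile _ _ _; set q := profile _ _ _.
have -> : P * p - Q * q = (P - Q) * p + Q * (p - q) by ring.
have h (s s' t : R) : `|s - s'| <= `|a - a'| ->
    `|profile e 0 (t - s) - profile e 0 (t - s')| <= bumpC * `|a - a'|.
  move=> ss; rewrite (le_trans (profile_lip _ _ _ e01))//.
  apply: ler_wpM2l; first exact/ltW/bumpC_gt0.
  have -> : t - s - (t - s') = s' - s by ring.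
  by rewrite distrC.
have -> : bumpC * N.+1%:R * `|a - a'| =
    bumpC * N%:R * `|a - a'| + bumpC * `|a - a'| by rewrite -[N.+1%:R]natr1; ring.
apply: le_trans (ler_normD _ _) _; apply: lerD.
  have p1 : `|p| <= 1 by exact: profile0_le1.
  apply: (@le_trans _ _ `|P - Q|).
    by rewrite normrM -[leRHS]mulr1; apply: ler_wpM2l.
  apply: le_trans (norm_prodB _ _ _) _ => [i|i|]; try exact: profile0_le1.
  rewrite (@le_trans _ _ (\sum_(i < N) (bumpC * `|a - a'|)))//.
    by apply: ler_sum => i _; apply: h; exact: norm_coordB.
  by rewrite sumr_const card_ord -[_ *+ N]mulr_natr mulrAC.
have Q1 : `|Q| <= 1 by apply: norm_prod_le1 => i; exact: profile0_le1.
apply: (@le_trans _ _ `|p - q|).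
  by rewrite normrM -[leRHS]mul1r; apply: ler_wpM2r.
by apply: h; exact: norm_timeB.
Qed.

Lemma bounded_measurable_mollifier e n m a : 0 <= e <= 1 ->
  bounded_measurable
    (mollifier e n m a : ('rV[R]_N * measurableTypeR R)%type -> R).
Proof.
move=> e01; split; first exact: measurable_mollifier.
exists ((\prod_(i < N) bumpC) * bumpC) => z; rewrite normrM ler_pM//.
  by rewrite normr_prod; apply: ler_prod => i _; rewrite normr_ge0/=; exact: profile_le.
exact: profile_le.
Qed.

End difference_quotients.

(** * Mollifications of solutions *)

Section comparison.
Context {R : realType} {N : nat}.
Local Notation X := ('rV[R]_N * R)%type.
Implicit Types (e s : R) (a z : X) (h u v w : X -> R) (p T : R).

Lemma nbhs_normX z (A : set X) :
  nbhs z A <-> exists2 e, 0 < e & forall z', `|z' - z| < e -> A z'.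
Proof.
split=> [/(@nbhs_normP _ _ z) [e /= e0 eA]|[e e0 eA]].
  by exists e => // z' z'z; apply: eA; rewrite /= distrC.
apply/(@nbhs_normP _ _ z); exists e => //= z' /= z'z; apply: eA.
by rewrite distrC.
Qed.

Lemma normX_lt (z a : X) e : 0 < e ->
  (forall i, `|z.1 ord0 i - a.1 ord0 i| < e) -> `|z.2 - a.2| < e -> `|z - a| < e.
Proof.
move=> e0 z1 z2; rewrite prod_normE gt_max z2 andbT.
rewrite [ltLHS]/Num.Def.normr/= mx_normrE; apply: bigmax_lt => // -[i j] _ /=.
by rewrite !mxE (ord1 i).
Qed.

(** Unlike in uniform continuity on [K], the point [z'] may lie outside [K]: a
    mollification at a point of [K] sees values of [u] around [K]. *)
Lemma compact_unif_near (K : set X) u k : compact K ->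
  (forall z, K z -> {for z, continuous u}) -> 0 < k ->
  exists2 e, 0 < e & forall z z', K z -> `|z' - z| < e -> `|u z' - u z| <= k.
Proof.
move=> cK cu k0.
have nc : forall z, K z -> \forall z1 \near z & e \near 0^'+,
    forall z', `|z' - z1| < e -> `|u z' - u z1| <= k.
  move=> z Kz.
  have k2 : 0 < k / 2 by rewrite divr_gt0.
  have /cvgrPdist_le/(_ _ k2)/nbhs_normX[d d0 dP] := cu z Kz.
  exists ([set z1 | `|z1 - z| < d / 2], [set e | e <= d / 2]) => /=.
    split; last by apply: nbhs_right_le; rewrite divr_gt0.
    by apply/nbhs_normX; exists (d / 2) => //; rewrite divr_gt0.
  move=> [z1 e] /= [z1z ed] z' z'z1.
  have h1 : `|u z - u z1| <= k / 2.
    by apply: dP; apply: lt_trans z1z _; lra.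
  have h2 : `|u z - u z'| <= k / 2.
    apply: dP.
    have -> : z' - z = (z' - z1) + (z1 - z) by rewrite addrA subrK.
    apply: le_lt_trans (ler_normD _ _) _; lra.
  have -> : u z' - u z1 = (u z - u z1) - (u z - u z') by ring.
  apply: le_trans (ler_normB _ _) _; lra.
have := (compact_near_coveringP K).1 cK _ _ _ _ nc => H.
have [e [e0 eP]] : exists e, 0 < e /\ (K `<=` [set z | forall z',
    `|z' - z| < e -> `|u z' - u z| <= k]).
  near (0 : R)^'+ => e; exists e; split; first by near: e; exact: nbhs_right_gt.
  by near: e; exact: H.
by exists e => // z z' Kz; exact: eP.
Unshelve. all: by end_near. Qed.

Lemma measurable_QT T :
  measurable (QT T : set ('rV[R]_N * measurableTypeR R)%type).
Proof.
have -> : (QT T : set X) = [set: 'rV[R]_N] `*` (`]0, T[%classic : set R).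
  by apply/seteqP; split=> z /=; rewrite in_itv/=; [|move=> -[]].
by apply: measurableX => //; exact: measurable_itv.
Qed.

Local Notation pair T u := (pairing (@mu_xt R N) (QT T) u).

Lemma integrable_mollifier T e a (c : R) : 0 < e <= 1 ->
  (\int[@mu_xt R N]_z (mollifier e (fun=> 0%N) 0 a z)%:E = c%:E)%E ->
  (@mu_xt R N).-integrable (QT T) (EFin \o mollifier e (fun=> 0%N) 0 a).
Proof.
move=> /andP[e0 e1] cE.
apply: (integrableS measurableT (measurable_QT T)) => //; apply/integrableP; split.
  by apply/measurable_EFinP; apply: measurable_mollifier; rewrite ltW.
under eq_integral do rewrite /= ger0_norm ?mollifier0_ge0//.
by rewrite cE ltry.
Qed.

Lemma Rintegral_mollifier T e a (c : R) : 0 < e -> e <= a.2 -> a.2 + e <= T ->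
  (\int[@mu_xt R N]_z (mollifier e (fun=> 0%N) 0 a z)%:E = c%:E)%E ->
  \int[@mu_xt R N]_(z in QT T) mollifier e (fun=> 0%N) 0 a z = c.
Proof.
move=> e0 ea aT cE; rewrite -[RHS]/(fine c%:E) -cE /Rintegral; congr fine.
rewrite [LHS]integral_mkcond; apply: eq_integral => z _.
rewrite patchE; case: ifPn => // zQ; congr EFin; apply/esym.
apply: mollifier_eq0; [exact: ltW|right].
rewrite leNgt; apply/negP => za.
move: zQ; rewrite notin_setE; apply; rewrite /QT/=.
by move: za; rewrite ltr_norml => /andP[? ?]; apply/andP; split; lra.
Qed.

Lemma mollifier_support e a z : 0 < e -> e <= `|z - a| ->
  mollifier e (fun=> 0%N) 0 a z = 0.
Proof.
move=> e0; have [//|rho0 az] := eqVneq (mollifier e (fun=> 0%N) 0 a z) 0.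
apply: mollifier_eq0; first exact: ltW.
apply: contrapT => /not_orP[/forallNP z1 /negP]; rewrite -ltNge => z2.
move: az; rewrite leNgt => /negP; apply; apply: normX_lt => // i.
by rewrite ltNge; apply/negP; exact: z1.
Qed.

Lemma pairing_mollifier_close T u e a (c k : R) :
  (@mu_xt R N).-integrable (QT T) (EFin \o u) -> 0 < e <= 1 ->
  e <= a.2 -> a.2 + e <= T ->
  (\int[@mu_xt R N]_z (mollifier e (fun=> 0%N) 0 a z)%:E = c%:E)%E ->
  (forall z, `|z - a| < e -> `|u z - u a| <= k) ->
  `|pair T u (mollifier e (fun=> 0%N) 0 a) - u a * c| <= k * c.
Proof.
move=> iu e01 ea aT cE uk; have e0 : 0 < e by case/andP: e01.
have irho := integrable_mollifier T e01 cE.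
have mQ := measurable_QT T.
have bm : bounded_measurable
    (mollifier e (fun=> 0%N) 0 a : ('rV[R]_N * measurableTypeR R)%type -> R).
  by apply: bounded_measurable_mollifier; case/andP: e01 => /ltW -> ->.
have iZ (b : R) : (@mu_xt R N).-integrable (QT T)
    (EFin \o (fun z => b * mollifier e (fun=> 0%N) 0 a z)).
  rewrite (_ : _ \o _ = (fun z => b%:E * (mollifier e (fun=> 0%N) 0 a z)%:E)%E).
    exact: (integrableZl mQ b irho).
  by apply/funext => z /=; rewrite EFinM.
have iu' := integrable_pairing mQ iu bm.
have iB := integrableB mQ iu' (iZ (u a)).
rewrite -(Rintegral_mollifier e0 ea aT cE) -!RintegralZl// -RintegralB//.
rewrite (le_trans (le_normr_Rintegral mQ iB))//.
apply: le_Rintegral => //; first exact: (integrable_norm iB).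
move=> z _; rewrite /= -mulrBl normrM (ger0_norm (mollifier0_ge0 _ _ _)).
have [za|az] := ltP `|z - a| e.
  by rewrite ler_wpM2r ?mollifier0_ge0// uk.
by rewrite mollifier_support// !mulr0.
Qed.

Lemma heatq_pairing T u e s a : (@mu_xt R N).-integrable (QT T) (EFin \o u) ->
  0 <= e <= 1 -> 0 < s ->
  `|heatq s (fun a => pair T u (mollifier e (fun=> 0%N) 0 a)) a
     - pair T u (mollifier_heat e a)|
    <= (2 * bumpC * N%:R + bumpC) * s * \int[@mu_xt R N]_(z in QT T) `|u z|.
Proof.
move=> iu e01 s0; have mQ := measurable_QT T.
pose rho a : ('rV[R]_N * measurableTypeR R)%type -> R := mollifier e (fun=> 0%N) 0 a.
have bm a' : bounded_measurable (rho a') by exact: bounded_measurable_mollifier.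
pose Z (k : R) a' z := k * rho a' z.
have bZ k a' : bounded_measurable (Z k a') := bounded_measurableZ k (bm a').
pose A i z := s ^- 2 * ((rho (a + s *: dir_x i) z + rho (a - s *: dir_x i) z) +
  Z (- 2) a z).
have bA2 i := bounded_measurableD (bm (a + s *: dir_x i)) (bm (a - s *: dir_x i)).
have bA3 i := bounded_measurableD (bA2 i) (bZ (- 2) a).
have bA i : bounded_measurable (A i) := bounded_measurableZ (s ^- 2) (bA3 i).
pose B z := - s^-1 * (rho a z + Z (- 1) (a - s *: @dir_t R N) z).
have bB1 := bounded_measurableD (bm a) (bZ (- 1) (a - s *: @dir_t R N)).
have bB : bounded_measurable B := bounded_measurableZ (- s^-1) bB1.
have bS := bounded_measurable_sum (index_enum 'I_N) bA.
pose F z := \sum_(i < N) A i z + B z.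
have bF : bounded_measurable F := bounded_measurableD bS bB.
have FE z : heatq s (fun a => mollifier e (fun=> 0%N) 0 a z) a = F z.
  rewrite /F /heatq /B; congr (_ + _); last by rewrite /Z /rho; ring.
  by apply: eq_bigr => i _; rewrite /A /Z /rho; ring.
have -> : heatq s (fun a => pair T u (mollifier e (fun=> 0%N) 0 a)) a = pair T u F.
  rewrite /F (pairingD mQ iu bS bB) (pairing_sum mQ iu _ bA).
  rewrite /heatq; congr (_ + _).
    apply: eq_bigr => i _; rewrite (pairingZ mQ iu _ (bA3 i)).
    by rewrite (pairingD mQ iu (bA2 i) (bZ _ _)) (pairingD mQ iu (bm _) (bm _))
      (pairingZ mQ iu _ (bm a)) mulNr.
  rewrite (pairingZ mQ iu _ bB1) (pairingD mQ iu (bm a) (bZ _ _)).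
  by rewrite (pairingZ mQ iu _ (bm _)) mulN1r mulNr.
have bH : bounded_measurable
    (mollifier_heat e a : ('rV[R]_N * measurableTypeR R)%type -> R).
  apply: bounded_measurableD; last exact: bounded_measurable_mollifier.
  by apply: bounded_measurable_sum => i; exact: bounded_measurable_mollifier.
have bH' := bounded_measurableZ (- 1) bH.
rewrite -mulN1r -(pairingZ mQ iu _ bH) -(pairingD mQ iu bF bH').
apply: (pairing_le mQ iu (bounded_measurableD bF bH')).
by move=> z _; rewrite mulN1r -FE; exact: heatq_mollifier.
Qed.

(** The equation is tested with the mollifier centred at [a], which vanishes at
    the origin, so the initial mass [k] does not enter. *)
Lemma pairing_mollifier_heat T p h k u e a (c L : R) :
  is_solution T p h k u -> 0 < e <= 1 -> e <= a.2 -> a.2 + e <= T ->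
  (\int[@mu_xt R N]_z (mollifier e (fun=> 0%N) 0 a z)%:E = c%:E)%E ->
  (forall z, QT T z -> `|z - a| < e -> L <= h z * u z `^ p) ->
  L * c <= pair T u (mollifier_heat e a).
Proof.
move=> [_ _ iu ihu weak] e01 ea aT cE Lh.
have e01' : 0 <= e <= 1 by case/andP: e01 => /ltW -> ->.
have e0 : 0 < e by case/andP: e01.
pose rho := mollifier e (fun=> 0%N) 0 a.
have bm n m := @bounded_measurable_mollifier R N e n m a e01'.
have bmh : bounded_measurable
    (mollifier_heat e a : ('rV[R]_N * measurableTypeR R)%type -> R).
  by apply: bounded_measurableD => //; exact: bounded_measurable_sum.
have mQ := measurable_QT T.
have ig := integrable_pairing mQ ihu (bm (fun=> 0%N) 0%N).
have iM := integrable_pairing mQ iu bmh.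
have rho0 : rho 0 = 0.
  by apply: mollifier_eq0; [exact: ltW|right; rewrite /= sub0r normrN (le_trans ea)// ler_norm].
have := weak _ (mollifier_test e01 aT).
rewrite -/rho rho0 mulr0 => weak0.
have eqI : \int[@mu_xt R N]_(z in QT T) (h z * u z `^ p * rho z) =
    pair T u (mollifier_heat e a).
  apply/eqP; rewrite -subr_eq0 -RintegralB//; apply/eqP.
  rewrite -[RHS]/(fine 0%:E) -weak0 /Rintegral; congr fine.
  apply: eq_integral => z _; congr EFin.
  rewrite derive_mollifier_t laplacian_mollifier /mollifier_heat; ring.
rewrite -eqI.
have irho := integrable_mollifier T e01 cE.
rewrite -(Rintegral_mollifier e0 ea aT cE).
rewrite -RintegralZl//; apply: le_Rintegral => //.
  rewrite (_ : _ \o _ = (fun z => L%:E * (rho z)%:E)%E).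
    exact: (integrableZl mQ L irho).
  by apply/funext => z /=; rewrite EFinM.
move=> z Qz.
have [za|az] := ltP `|z - a| e.
  by rewrite ler_wpM2r ?mollifier0_ge0// Lh.
by rewrite /rho mollifier_support// !mulr0.
Qed.

End comparison.

(** * The comparison principle *)

Section comparison_principle.
Context {R : realType} {N : nat}.
Local Notation X := ('rV[R]_N * R)%type.
Implicit Types (e s : R) (a z : X) (h u v w : X -> R) (p T : R).

Lemma QT_nbhs T z : QT T z -> nbhs z (QT T : set X).
Proof.
move=> /andP[z0 zT]; apply/nbhs_normX.
exists (Num.min z.2 (T - z.2)); first by rewrite lt_min z0 subr_gt0.
move=> z'; rewrite lt_min => /andP[h1 h2].
have := norm_timeB z' z; rewrite ler_norml => /andP[h3 h4].
by rewrite /QT/=; apply/andP; split; lra.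
Qed.

Lemma within_nbhs_continuous (A : set X) (f : X -> R) z :
  {within A, continuous f} -> nbhs z A -> {for z, continuous f}.
Proof.
move=> /subspace_continuousP cf zA.
have /cf fz := nbhs_singleton zA.
move=> B /fz; rewrite /= /nbhs/= /within/= => BA.
by apply: filterS (filterI zA BA) => y [Ay]; exact.
Qed.

Lemma solution_continuous T p h k u z : is_solution T p h k u -> QT T z ->
  {for z, continuous u}.
Proof.
move=> [_ cu _ _ _] Qz; apply: (within_nbhs_continuous cu).
apply: filterS (QT_nbhs Qz) => y /andP[y0 yT]; split.
  by rewrite /QTbar/= !ltW.
by move=> y0'; move: y0; rewrite y0' /= ltxx.
Qed.

Lemma cylinder_move_x (x : 'rV[R]_N) r t1 t2 z s (i : 'I_N) :
  cylinder x r t1 t2 z -> `|s| <= r - `|z.1 ord0 i - x ord0 i| ->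
  cylinder x r t1 t2 (z + s *: dir_x i).
Proof.
move=> [zx zt] si; split; last by rewrite /= scaler0 addr0.
move=> j /=; rewrite !mxE eqxx /=; have [->|ji] := eqVneq j i.
  rewrite mulr1 addrAC; apply: le_trans (ler_normD _ _) _; lra.
by rewrite mulr0 addr0.
Qed.

Lemma cylinder_move_t (x : 'rV[R]_N) r t1 t2 z s : cylinder x r t1 t2 z ->
  0 <= s <= z.2 - t1 -> cylinder x r t1 t2 (z - s *: @dir_t R N).
Proof.
move=> [zx /andP[zt1 zt2]] /andP[s0 st]; split.
  by move=> i; rewrite /= scaler0 subr0.
by rewrite /= /GRing.scale/= mulr1; apply/andP; split; lra.
Qed.

(** If [u] exceeded [w] somewhere, then a mollification of [u] minus [w], slightly
    tilted in time, would be maximal at a point off the parabolic boundary, since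
    mollifications converge uniformly to [u] on the cylinder. There the quotient
    [heatq] of the mollification is at most that of [w] minus the tilt, hence at
    most c w^p minus the tilt. The equation bounds it from below by the average
    of h u^p, in which h >= c and, by uniform continuity, u exceeds the value of
    [w] at the maximum. Only difference quotients of [w] are mentioned, so that
    constants and explicit barriers are treated alike. *)
Theorem comparison_principle T p h k u (x : 'rV[R]_N) r t1 t2 c w e0 :
  0 <= p -> is_solution T p h k u -> 0 < t1 -> t2 < T -> 0 <= c -> 0 < e0 ->
  (forall z z', cylinder x r t1 t2 z -> QT T z' -> `|z' - z| < e0 -> c <= h z') ->
  {within cylinder x r t1 t2, continuous w} ->
  (forall z, cylinder x r t1 t2 z -> 0 <= w z) ->
  (forall z, cylinder x r t1 t2 z ->
    z.2 = t1 \/ (exists i, `|z.1 ord0 i - x ord0 i| = r) -> u z <= w z) ->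
  (forall z, cylinder x r t1 t2 z ->
    (forall i, `|z.1 ord0 i - x ord0 i| < r) -> t1 < z.2 ->
    forall eps, 0 < eps -> \forall s \near 0^'+, heatq s w z <= c * w z `^ p + eps) ->
  forall z, cylinder x r t1 t2 z -> u z <= w z.
Proof.
move=> p0 sol t10 t2T c0 e00 hc cw w0 ub wL zs Czs.
have [_ _ iu _ _] := sol.
rewrite leNgt; apply/negP => uw.
set Cyl := cylinder x r t1 t2.
have t12 : t1 <= t2 by case: Czs => _ /andP[]; exact: le_trans.
have CQ z : Cyl z -> QT T z.
  by move=> [_ /andP[? ?]]; rewrite /QT/=; apply/andP; split; lra.
have cuC z : Cyl z -> {for z, continuous u}.
  by move=> /CQ; exact: solution_continuous sol.
pose m := u zs - w zs; have m0 : 0 < m by rewrite subr_gt0.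
(* The tilt del * (t - t1) makes the supersolution strict and is at most m / 2. *)
pose del := m / (2 * (t2 - t1 + 1)).
have D0 : 0 < 2 * (t2 - t1 + 1) by lra.
have del0 : 0 < del by rewrite divr_gt0.
have delt z : Cyl z -> 0 <= del * (z.2 - t1) <= m / 2.
  move=> [_ /andP[z1 z2]]; rewrite mulr_ge0 ?subr_ge0 ?(ltW del0)//=.
  rewrite /del mulrAC ler_pdivrMr// -mulrA ler_pM2l//; lra.
have k0 : 0 < m / 8 by rewrite divr_gt0.
have [e1 e10 e1P] := compact_unif_near (@cylinder_compact R N x r t1 t2) cuC k0.
pose e := Num.min (Num.min 1 e0) (Num.min e1 (Num.min t1 (T - t2))).
have e_gt0 : 0 < e by rewrite !lt_min ltr01 e00 e10 t10 subr_gt0.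
have [ee1 ee0 eeu eet eeT] : [/\ e <= 1, e <= e0, e <= e1, e <= t1 & e <= T - t2].
  by rewrite /e !ge_min !lexx !orbT.
have e01 : 0 < e <= 1 by rewrite e_gt0.
have e01' : 0 <= e <= 1 by rewrite ltW.
have [C C0 CE] := @integral_mollifier R N e e01.
have mQ := @measurable_QT R N T.
pose rho a : X -> R := mollifier e (fun=> 0%N) 0 a.
have bm a := @bounded_measurable_mollifier R N e (fun=> 0%N) 0 a e01'.
pose v a := C^-1 * pairing (@mu_xt R N) (QT T) u (rho a).
pose U := \int[@mu_xt R N]_(z in QT T) `|u z|.
have U0 : 0 <= U by apply: Rintegral_ge0.
have vu z : Cyl z -> `|v z - u z| <= m / 8.
  move=> Cz; have [h1 h2] : e <= z.2 /\ z.2 + e <= T.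
    by case: Cz => _ /andP[? ?]; split; lra.
  have := pairing_mollifier_close iu e01 h1 h2 (CE z)
    (fun z' zz' => e1P z z' Cz (lt_le_trans zz' eeu)).
  rewrite (_ : v z - u z = C^-1 * (pairing (@mu_xt R N) (QT T) u (rho z) - u z * C)).
    by rewrite normrM gtr0_norm ?invr_gt0// ler_pdivrMl// [C * _]mulrC.
  by rewrite /v; field; exact: lt0r_neq0.
have cv : continuous v.
  move=> a; apply/cvgrPdist_le => eps eps0; apply/nbhs_normX.
  pose K := bumpC * N.+1%:R * U.
  have K0 : 0 <= K by rewrite !mulr_ge0// ltW// bumpC_gt0.
  exists (eps * C / (K + 1)); first by rewrite !mulr_gt0// invr_gt0; lra.
  move=> b ba /=.
  have bN : bounded_measurable (fun z : 'rV[R]_N * measurableTypeR R => - rho b z).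
    have := bounded_measurableZ (-1) (bm b).
    by congr bounded_measurable; apply/funext => z; rewrite mulN1r.
  have -> : v a - v b = C^-1 * pairing (@mu_xt R N) (QT T) u (fun z => rho a z - rho b z).
    by rewrite (pairingD mQ iu (bm a) bN) (pairingN mQ iu (bm b)) mulrBr.
  rewrite normrM gtr0_norm ?invr_gt0// mulrC ler_pdivrMr//.
  apply: le_trans (pairing_le mQ iu (bounded_measurableD (bm a) bN) _) _.
    by move=> z _; exact: mollifier_lip.
  rewrite distrC mulrAC -/K.
  apply: (@le_trans _ _ (K * (eps * C / (K + 1)))).
    by rewrite ler_wpM2l// ltW.
  rewrite mulrA ler_pdivrMr ?ltr_wpDl// mulrC ler_wpM2l ?mulr_ge0 ?ltW//; lra.
pose V z := v z - w z - del * (z.2 - t1).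
have cV : {within Cyl, continuous V}.
  move=> z; apply: cvgB; first apply: cvgB.
  - exact: (continuous_subspaceT cv).
  - exact: cw.
  - apply: (continuous_subspaceT (f := fun z : X => del * (z.2 - t1))) => y.
    apply: cvgM; first exact: cvg_cst.
    by apply: cvgB; [exact: cvg_snd|exact: cvg_cst].
have [z0 /set_mem Cz0 Vz0] := compact_EVT_max (ex_intro _ zs Czs)
  (@cylinder_compact R N x r t1 t2) cV.
have Vmax z : Cyl z -> V z <= V z0 by move=> Cz; apply: Vz0; exact: mem_set.
have uz0 : w z0 + m / 8 <= u z0.
  have := Vmax _ Czs; rewrite /V.
  have := vu _ Cz0; have := vu _ Czs; rewrite !ler_norml => /andP[? ?] /andP[? ?].
  have := delt _ Czs; have := delt _ Cz0 => /andP[? ?] /andP[? ?].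
  rewrite -/m in m0 k0 *; have mE : m = u zs - w zs by []; lra.
have z0i i : `|z0.1 ord0 i - x ord0 i| < r.
  rewrite lt_neqAle (Cz0.1 i) andbT; apply/eqP => zr.
  have : u z0 <= w z0 by apply: ub => //; right; exists i.
  lra.
have z0t : t1 < z0.2.
  have [_ /andP[+ _]] := Cz0; rewrite le_eqVlt => /predU1P[zt|//].
  have : u z0 <= w z0 by apply: ub => //; left.
  lra.
have [ez0 ezT] : e <= z0.2 /\ z0.2 + e <= T.
  by case: Cz0 => _ /andP[? ?]; split; lra.
have LI : (c * w z0 `^ p) * C <= pairing (@mu_xt R N) (QT T) u (mollifier_heat e z0).
  apply: (pairing_mollifier_heat sol e01 ez0 ezT (CE z0)) => z Qz zz0.
  have zu : `|u z - u z0| <= m / 8.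
    by apply: e1P => //; exact: lt_le_trans zz0 eeu.
  have wu : w z0 <= u z by move: zu; rewrite ler_norml => /andP[? ?]; lra.
  have hcz : c <= h z by apply: (hc z0) => //; exact: lt_le_trans zz0 ee0.
  apply: ler_pM => //; first exact: powR_ge0.
  by rewrite ge0_ler_powR ?nnegrE// ?w0//; apply: le_trans wu; exact: w0.
pose K := (2 * bumpC * N%:R + bumpC) * U.
have K0 : 0 <= K by rewrite !mulr_ge0// addr_ge0 ?mulr_ge0// ltW// bumpC_gt0.
have qv s : 0 < s ->
    pairing (@mu_xt R N) (QT T) u (mollifier_heat e z0) - K * s <= C * heatq s v z0.
  move=> s0; have := heatq_pairing z0 iu e01' s0.
  rewrite mulrAC -/K (_ : heatq s _ z0 = C * heatq s v z0).
    by rewrite ler_norml => /andP[+ _]; lra.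
  rewrite -heatqZ; congr heatq; apply/funext => a.
  by rewrite /v mulVKf ?gt_eqF.
have K1 : 0 < K + 1 by rewrite ltr_wpDl.
have d4 : 0 < del / 4 by rewrite divr_gt0.
have Cd4 : 0 < C * (del / 4) by rewrite mulr_gt0.
have small : \forall s \near 0^'+, [/\ 0 < s, s <= z0.2 - t1,
    (forall i, s <= r - `|z0.1 ord0 i - x ord0 i|), K * s <= C * (del / 4) &
    heatq s w z0 <= c * w z0 `^ p + del / 4].
  near=> s; split.
  - by near: s; exact: nbhs_right_gt.
  - by near: s; apply: nbhs_right_le; rewrite subr_gt0.
  - near: s; apply: filter_forall => i.
    by apply: nbhs_right_le; rewrite subr_gt0.
  - have : s <= C * (del / 4) / (K + 1).
      near: s; apply: nbhs_right_le.
      exact: divr_gt0 Cd4 K1.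
    rewrite ler_pdivlMr ?ltr_wpDl// => hs; apply: le_trans hs.
    by rewrite mulrDr mulr1 [K * s]mulrC lerDl ltW.
  - by near: s; apply: wL => //; rewrite divr_gt0.
near (0 : R)^'+ => s.
have [s0 st si Ks ws] : [/\ 0 < s, s <= z0.2 - t1,
    (forall i, s <= r - `|z0.1 ord0 i - x ord0 i|), K * s <= C * (del / 4) &
    heatq s w z0 <= c * w z0 `^ p + del / 4] by near: s; exact: small.
have qV : heatq s V z0 <= 0.
  rewrite /heatq subr_le0 (@le_trans _ _ 0)//.
    apply: sumr_le0 => i _; rewrite mulr_ge0_le0 ?invr_ge0 ?exprn_ge0 ?(ltW s0)//.
    have h1 : V (z0 + s *: dir_x i) <= V z0.
      by apply/Vmax/cylinder_move_x => //; rewrite gtr0_norm.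
    have h2 : V (z0 - s *: dir_x i) <= V z0.
      by rewrite -scaleNr; apply/Vmax/cylinder_move_x => //; rewrite normrN gtr0_norm.
    lra.
  rewrite mulr_ge0 ?invr_ge0 ?(ltW s0)// subr_ge0.
  by apply/Vmax/cylinder_move_t => //; rewrite ltW.
have : heatq s V z0 = heatq s v z0 - heatq s w z0 + del.
  rewrite /V heatqB heatqB (@heatqZ _ _ s del (fun z => z.2 - t1)).
  by rewrite heatq_time//; ring.
have := qv _ s0 => h1 h2.
have h3 : heatq s v z0 <= c * w z0 `^ p - del * (3 / 4) by lra.
have h4 : C * heatq s v z0 <= C * (c * w z0 `^ p - del * (3 / 4)).
  by rewrite ler_wpM2l// ltW.
have h5 : 0 < C * del by rewrite mulr_gt0.
lra.
Unshelve. all: by end_near. Qed.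

End comparison_principle.

(** * One-dimensional barriers *)

Section barrier.
Context {R : realType}.
Implicit Types (f g : R -> R) (r s x y p eps : R) (n : nat).

Lemma second_difference_near f (f1 f2 : R -> R) r eps :
  (\forall x \near r, is_derive (x : R) 1 f (f1 x)) ->
  (\forall x \near r, is_derive (x : R) 1 f1 (f2 x)) ->
  {for r, continuous f2} -> 0 < eps ->
  \forall s \near 0^'+, s ^- 2 * (f (r + s) + f (r - s) - 2 * f r) <= f2 r + eps.
Proof.
move=> df df1 cf2 eps0.
have e2 : 0 < eps / 2 by rewrite divr_gt0.
have cf2r : \forall x \near r, `|f2 r - f2 x| <= eps / 2.
  by move/cvgrPdist_le : cf2; exact.
have /nbhs_ballP[d /= d0 dP] : \forall x \near r, [/\ is_derive (x : R) 1 f (f1 x),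
    is_derive x 1 f1 (f2 x) & `|f2 r - f2 x| <= eps / 2].
  by apply: filterS3 df df1 cf2r.
near=> s.
have s0 : 0 < s by near: s; exact: nbhs_right_gt.
have sd : s < d by near: s; exact: nbhs_right_lt.
have xd x : `|x - r| <= s -> `|r - x| < d by rewrite distrC => /le_lt_trans; apply.
have H : `|f (r + s) + f (r - s) - 2 * f r - s ^+ 2 * f2 r| <= 2 * (eps / 2) * s ^+ 2.
  apply: (@second_difference R f f1 f2 r s (eps / 2) (ltW s0)) => x xs.
  - by have [] := dP _ (xd x xs).
  - by have [] := dP _ (xd x xs).
  - by rewrite distrC; have [] := dP _ (xd x xs).
rewrite ler_pdivrMl ?exprn_gt0// mulrDr.
move: H; rewrite [2 * (eps / 2)]mulrC divfK// ler_norml => /andP[_].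
by rewrite lerBlDl [eps * _]mulrC.
Unshelve. all: by end_near. Qed.

Lemma first_difference_near f (f1 : R -> R) r eps :
  (\forall x \near r, is_derive (x : R) 1 f (f1 x)) -> {for r, continuous f1} -> 0 < eps ->
  \forall s \near 0^'+, - (s^-1 * (f r - f (r - s))) <= - f1 r + eps.
Proof.
move=> df cf1 eps0.
have cf1r : \forall x \near r, `|f1 r - f1 x| <= eps by move/cvgrPdist_le : cf1; exact.
have /nbhs_ballP[d /= d0 dP] : \forall x \near r,
    is_derive (x : R) 1 f (f1 x) /\ `|f1 r - f1 x| <= eps.
  by apply: filterS2 df cf1r.
near=> s.
have s0 : 0 < s by near: s; exact: nbhs_right_gt.
have sd : s < d by near: s; exact: nbhs_right_lt.
have sN : `|- s| = s by rewrite normrN gtr0_norm.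
have xd x : `|x - r| <= `|- s| -> `|r - x| < d.
  by rewrite sN distrC => /le_lt_trans; apply.
have := @first_difference R f f1 r (- s) eps (fun x xs => (dP _ (xd x xs)).1).
have -> : - (s^-1 * (f r - f (r - s))) = s^-1 * (f (r - s) - f r) by ring.
rewrite sN ler_pdivrMl// mulrDr => H.
have {H} : `|f (r - s) - f r - - s * f1 r| <= eps * s.
  by apply: H => x; rewrite -[X in _ <= X -> _]sN => xs; rewrite distrC; have [] := dP _ (xd x xs).
rewrite ler_norml => /andP[_]; rewrite mulNr opprK mulrN; lra.
Unshelve. all: by end_near. Qed.

Lemma is_derive_inv f x df : f x != 0 -> is_derive x 1 f df ->
  is_derive x 1 (fun x => (f x)^-1) (- (f x) ^- 2 * df).
Proof.
move=> fx0 [dfx <-]; apply: DeriveDef; first exact: derivableV.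
by rewrite deriveV.
Qed.

(** The barriers blow up at both ends of ]-r, r[ in space and at -r in time; they
    are functions of one variable, to be added rather than multiplied. *)
Definition space_barrier r n s : R := (r ^+ 2 - s ^+ 2)^-1 ^+ n.
Definition time_barrier r n s : R := (s + r)^-1 ^+ n.

Definition space_barrier1 r n s : R := n%:R * 2 * (s * space_barrier r n.+1 s).
Definition space_barrier2 r n s : R := n%:R * 2 *
  (space_barrier r n.+1 s + n.+1%:R * 2 * (s ^+ 2 * space_barrier r n.+2 s)).

Lemma gap_gt0 r s : `|s| < r -> 0 < r ^+ 2 - s ^+ 2.
Proof.
move=> sr; rewrite subr_gt0 -(real_normK (num_real s)).
by rewrite ltr_pXn2r ?nnegrE// (le_trans _ (ltW sr)).
Qed.

Lemma is_derive_space_barrier r n s : `|s| < r ->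
  is_derive s 1 (space_barrier r n.+1) (space_barrier1 r n.+1 s).
Proof.
move=> /gap_gt0 /lt0r_neq0 gap.
have d1 : is_derive s 1 (fun s : R => r ^+ 2 - s ^+ 2) (- 2 * s).
  by apply: is_derive_eq; rewrite /GRing.scale/=; ring.
have d2 := @is_derive_inv (fun s => r ^+ 2 - s ^+ 2) s _ gap d1.
have -> : space_barrier r n.+1 = (fun s => (r ^+ 2 - s ^+ 2)^-1) ^+ n.+1.
  by rewrite exprfctE.
apply: is_derive_eq; rewrite /space_barrier1 /space_barrier /GRing.scale/=.
by rewrite -exprVn !exprS; ring.
Qed.

Lemma is_derive_space_barrier1 r n s : `|s| < r ->
  is_derive s 1 (space_barrier1 r n) (space_barrier2 r n s).
Proof.
move=> sr; have ? := is_derive_space_barrier n sr; rewrite /space_barrier1.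
apply: is_derive_eq; rewrite /space_barrier2 /space_barrier1 /GRing.scale/=; ring.
Qed.

Lemma continuous_space_barrier r n s : `|s| < r ->
  {for s, continuous (space_barrier r n)}.
Proof.
move=> /gap_gt0 /lt0r_neq0 gap.
apply: (@continuous_cvg _ _ _ _ _ (fun s : R => (r ^+ 2 - s ^+ 2)^-1) (fun y : R => y ^+ n)).
  exact: exprn_continuous.
apply: cvgV => //; apply: cvgB; first exact: cvg_cst.
exact: exprn_continuous.
Qed.

Lemma continuous_space_barrier2 r n s : `|s| < r ->
  {for s, continuous (space_barrier2 r n)}.
Proof.
move=> sr; apply: cvgM; first exact: cvg_cst.
apply: cvgD; first exact: continuous_space_barrier.
apply: cvgM; first exact: cvg_cst.
by apply: cvgM; [exact: exprn_continuous|exact: continuous_space_barrier].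
Qed.

Lemma is_derive_time_barrier r n s : - r < s ->
  is_derive s 1 (time_barrier r n.+1) (- (n.+1%:R * time_barrier r n.+2 s)).
Proof.
move=> sr; have gap : s + r != 0 by rewrite gt_eqF//; lra.
have d1 : is_derive s 1 (fun s : R => s + r) 1.
  by apply: is_derive_eq; rewrite addr0.
have d2 := @is_derive_inv (fun s => s + r) s _ gap d1.
have -> : time_barrier r n.+1 = (fun s => (s + r)^-1) ^+ n.+1 by rewrite exprfctE.
apply: is_derive_eq; rewrite /time_barrier /GRing.scale/=.
by rewrite -exprVn !exprS; ring.
Qed.

Lemma continuous_time_barrier r n s : - r < s ->
  {for s, continuous (time_barrier r n)}.
Proof.
move=> sr.
apply: (@continuous_cvg _ _ _ _ _ (fun s : R => (s + r)^-1) (fun y : R => y ^+ n)).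
  exact: exprn_continuous.
apply: cvgV; first by rewrite gt_eqF//; lra.
by apply: cvgD; [exact: cvg_id|exact: cvg_cst].
Qed.

(** The exponent of the barrier is large enough for its second derivative to be
    dominated by its p-th power. *)
Lemma expr_powR_ge n p y : 1 <= y -> 2 <= n%:R * (p - 1) ->
  y ^+ n.+2 <= (y ^+ n) `^ p.
Proof.
move=> y1 np; have y0 : 0 <= y by exact: le_trans y1.
rewrite -!powR_mulrn// -powRrM ler_powR// -[n.+2]addn2 natrD.
by move: np; rewrite mulrBr mulr1 lerBrDl addrC.
Qed.

Lemma space_barrier2_le n p r s : `|s| < r -> r <= 1 -> 2 <= n%:R * (p - 1) ->
  space_barrier2 r n s <= n%:R * 2 * (1 + n.+1%:R * 2) * space_barrier r n s `^ p.
Proof.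
move=> sr r1 np; have gap := gap_gt0 sr.
have r0 : 0 <= r by apply: le_trans (ltW sr).
have s1 : s ^+ 2 <= 1.
  by rewrite -(real_normK (num_real s)) exprn_ile1// (le_trans (ltW sr)).
have y1 : 1 <= (r ^+ 2 - s ^+ 2)^-1.
  rewrite invf_ge1//; have := sqr_ge0 s; have : r ^+ 2 <= 1 by rewrite exprn_ile1.
  lra.
set y := _^-1 in y1.
have h := expr_powR_ge y1 np.
rewrite /space_barrier2 /space_barrier -/y -[leRHS]mulrA ler_wpM2l ?mulr_ge0//.
rewrite mulrDl mul1r lerD//.
  by apply: le_trans h; exact: ler_weXn2l.
apply: ler_wpM2l; first by rewrite mulr_ge0.
apply: le_trans h; rewrite -[leRHS]mul1r; apply: ler_wpM2r => //.
by rewrite exprn_ge0// (le_trans _ y1).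
Qed.

Lemma time_barrier1_le n p r s : - r < s -> s <= r -> r <= 1 / 2 ->
  2 <= n%:R * (p - 1) ->
  n%:R * time_barrier r n.+1 s <= n%:R * 2 * (1 + n.+1%:R * 2) * time_barrier r n s `^ p.
Proof.
move=> sr sr' r1 np.
have y1 : 1 <= (s + r)^-1 by rewrite invf_ge1; lra.
have h := expr_powR_ge y1 np; rewrite /time_barrier; set y := _^-1 in y1 h *.
rewrite -!mulrA ler_wpM2l//.
have h' : y ^+ n.+1 <= (y ^+ n) `^ p by apply: le_trans h; exact: ler_weXn2l.
apply: (le_trans h'); have : 0 <= (y ^+ n) `^ p by exact: powR_ge0.
have : 0 <= n.+1%:R :> R by [].
nra.
Qed.

End barrier.

(** * The Keller-Osserman bound *)

Section keller_osserman.
Context {R : realType} {N : nat}.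
Local Notation X := ('rV[R]_N * R)%type.

Lemma heatq_separable (f : 'I_N -> R -> R) (g : R -> R) (s : R) (z : X) :
  heatq s (fun z => \sum_i f i (z.1 ord0 i) + g z.2) z =
  \sum_i s ^- 2 * (f i (z.1 ord0 i + s) + f i (z.1 ord0 i - s) - 2 * f i (z.1 ord0 i))
  - s^-1 * (g z.2 - g (z.2 - s)).
Proof.
rewrite /heatq; congr (_ - _ * _); last first.
  have -> : (z - s *: @dir_t R N).1 = z.1 by rewrite /= scaler0 subr0.
  have -> : (z - s *: @dir_t R N).2 = z.2 - s by rewrite /= /GRing.scale/= mulr1.
  ring.
apply: eq_bigr => i _; congr (_ * _).
have move_i (k : R) : \sum_j f j ((z.1 + k *: delta_mx ord0 i) ord0 j) =
    \sum_j f j (z.1 ord0 j) + (f i (z.1 ord0 i + k) - f i (z.1 ord0 i)).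
  rewrite (bigD1 i)//= [in RHS](bigD1 i)//= !mxE !eqxx mulr1.
  rewrite (eq_bigr (fun j => f j (z.1 ord0 j))); first by ring.
  by move=> j /negPf ji; rewrite !mxE ji andbF mulr0 addr0.
rewrite /= -scaleNr !move_i !scaler0 addr0 subr0; ring.
Qed.

(** A large multiple of the sum of the barriers in all variables is a
    supersolution of the equation with [h] replaced by [c], since the derivatives
    of each barrier are dominated by its own p-th power. It is infinite on the
    parabolic boundary of a cylinder around [z0], so it exceeds any given
    solution on that of a slightly smaller cylinder, and it does not depend on
    the solution. *)
Theorem keller_osserman (T p : R) (h : X -> R) (z0 : X) (r0 c : R) :
  1 < p -> QT T z0 -> 0 < r0 -> 0 < c ->
  (forall z, QT T z -> `|z - z0| < r0 -> c <= h z) ->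
  exists2 d : R, 0 < d & exists M : R, forall k (u : X -> R), is_solution T p h k u ->
    forall z, `|z - z0| < d -> u z <= M.
Proof.
move=> p1 /andP[b0 bT] r00 c0 hc; set b := z0.2 in b0 bT; set x := z0.1.
pose r := Num.min (Num.min (1 / 2) (b / 2)) (Num.min ((T - b) / 2) (r0 / 2)).
have r_gt0 : 0 < r by rewrite !lt_min !divr_gt0// subr_gt0.
have [r12 rb rT rr0] : [/\ r <= 1 / 2, r <= b / 2, r <= (T - b) / 2 & r <= r0 / 2].
  by rewrite /r !ge_min !lexx !orbT.
clearbody r.
(* n = m + 1, so that the barriers dominate 1 / y. *)
have [m np] : exists m : nat, 2 <= m.+1%:R * (p - 1).
  exists (Num.bound (2 / (p - 1))); rewrite -ler_pdivrMr ?subr_gt0//.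
  apply: (le_trans (ltW (archi_boundP _))); last by rewrite ler_nat.
  by rewrite divr_ge0// subr_ge0 ltW.
set n := m.+1 in np.
pose Kc : R := n%:R * 2 * (1 + n.+1%:R * 2).
have Kc0 : 0 < Kc by rewrite !mulr_gt0// addr_gt0.
(* The solution of B * Kc * (N + 1) = c * B ^ p; there are N + 1 barriers. *)
pose B := (Kc * N.+1%:R / c) `^ (p - 1)^-1.
have B0 : 0 < B by apply: powR_gt0; rewrite divr_gt0// mulr_gt0.
have BE : B * (Kc * N.+1%:R) = c * B `^ p.
  have -> : B `^ p = B * B `^ (p - 1).
    rewrite -{2}[B]powRr1 ?(ltW B0)// -powRD; last by apply/implyP => _; exact: lt0r_neq0.
    by rewrite addrC subrK.
  rewrite /B -[in RHS]powRrM mulVf ?gt_eqF ?subr_gt0//.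
  rewrite powRr1; last by rewrite divr_ge0 ?mulr_ge0 ?ltW.
  by field; exact: lt0r_neq0.
pose sb := space_barrier r n; pose tb := time_barrier r n.
pose W (z : X) := \sum_i sb (z.1 ord0 i - x ord0 i) + tb (z.2 - b).
have sb0 s : `|s| < r -> 0 < sb s.
  by move=> sr; rewrite exprn_gt0// invr_gt0 gap_gt0.
have tb0 s : - r < s -> 0 < tb s by move=> sr; rewrite exprn_gt0// invr_gt0; lra.
exists (r / 2); first by rewrite divr_gt0.
exists (B * (\sum_(i < N) sb (r / 2) + tb (- (r / 2)))) => k u sol z1 z1r.
have C0z : cylinder x r (b - r) (b + r) z0.
  by split=> [i|]; [rewrite subrr normr0 ltW|apply/andP; split; rewrite -/b; lra].
have cu z : cylinder x r (b - r) (b + r) z -> {for z, continuous u}.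
  move=> [_ /andP[? ?]]; apply: (solution_continuous sol).
  by apply/andP; split; lra.
have cuw : {within cylinder x r (b - r) (b + r), continuous u}.
  by apply: continuous_in_subspaceT => z /set_mem; exact: cu.
have [zm _ um] := compact_EVT_max (ex_intro _ z0 C0z)
  (@cylinder_compact R N x r (b - r) (b + r)) cuw.
pose Mu := Num.max 0 (u zm).
have Mu0 : 0 <= Mu by rewrite le_max lexx.
have uMu z : cylinder x r (b - r) (b + r) z -> u z <= Mu.
  by move=> Cz; rewrite le_max um ?orbT//; exact: mem_set.
pose eta := Num.min (r / 2) (B / (Mu + 1)).
have eta0 : 0 < eta by rewrite lt_min !divr_gt0// ltr_wpDl.
have [eta_r eta_B] : eta <= r / 2 /\ eta <= B / (Mu + 1).
  by rewrite /eta !ge_min !lexx !orbT.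
clearbody eta.
pose r' := r - eta.
have r'_gt : r / 2 <= r' by rewrite /r'; lra.
have r'_lt : r' < r by rewrite /r'; lra.
(* Since y <= 1, the n-th power of 1 / y is at least 1 / y >= (Mu + 1) / B. *)
have big_barrier y : 0 < y -> y <= eta -> Mu <= B * y^-1 ^+ n.
  move=> y0 ye; have y1 : 1 <= y^-1 by rewrite invf_ge1//; lra.
  apply: (@le_trans _ _ (B * y^-1)); last first.
    by rewrite ler_wpM2l ?(ltW B0)// -[leLHS]expr1 ler_weXn2l.
  have : y <= B / (Mu + 1) by exact: le_trans eta_B.
  rewrite !ler_pdivlMr// ?ltr_wpDl// mulrDr mulr1 mulrC; lra.
have sub z : cylinder x r' (b - r') (b + r') z -> cylinder x r (b - r) (b + r) z.
  move=> [zx /andP[? ?]]; split; last by apply/andP; split; lra.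
  by move=> i; rewrite (le_trans (zx i))// ltW.
have in_s z i : cylinder x r' (b - r') (b + r') z -> `|z.1 ord0 i - x ord0 i| < r.
  by move=> [zx _]; exact: le_lt_trans r'_lt.
have in_t z : cylinder x r' (b - r') (b + r') z -> - r < z.2 - b <= r.
  by move=> [_ /andP[? ?]]; apply/andP; split; lra.
have W0 z : cylinder x r' (b - r') (b + r') z -> 0 <= W z.
  move=> Cz; rewrite addr_ge0// ?sumr_ge0// => [i _|].
    by rewrite ltW// sb0// in_s.
  by rewrite ltW// tb0//; case/andP: (in_t _ Cz).
have sb_le z i : cylinder x r' (b - r') (b + r') z -> sb (z.1 ord0 i - x ord0 i) <= W z.
  move=> Cz; rewrite /W (bigD1 i)//= -addrA lerDl addr_ge0//.
    by rewrite sumr_ge0// => j _; rewrite ltW// sb0// in_s.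
  by rewrite ltW// tb0//; case/andP: (in_t _ Cz).
have tb_le z : cylinder x r' (b - r') (b + r') z -> tb (z.2 - b) <= W z.
  move=> Cz; rewrite /W lerDr sumr_ge0// => j _.
  by rewrite ltW// sb0// in_s.
have uW : forall z, cylinder x r' (b - r') (b + r') z -> u z <= B * W z.
  apply: (@comparison_principle R N T p h k u x r' (b - r') (b + r') c
    (fun z => B * W z) r) => //.
  - lra.
  - lra.
  - lra.
  - exact: ltW.
  - move=> z z' Cz Qz' zz'; apply: hc => //.
    have -> : z' - z0 = (z' - z) + (z - z0) by rewrite addrA subrK.
    apply: (le_lt_trans (ler_normD _ _)).
    have : `|z - z0| < r.
      apply: normX_lt => // [i|]; first exact: in_s.
      by rewrite -/b ltr_norml; case: Cz => _ /andP[? ?]; apply/andP; split; lra.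
    lra.
  - apply: continuous_in_subspaceT => z /set_mem Cz.
    apply: cvgM; first exact: cvg_cst.
    apply: cvgD.
      apply: cvg_big => [|i _]; first exact: add_continuous.
      apply: (@continuous_cvg _ _ _ _ _ (fun z : X => z.1 ord0 i - x ord0 i) sb).
        by apply: continuous_space_barrier; exact: in_s.
      by apply: cvgB; [exact: continuous_coord|exact: cvg_cst].
    apply: (@continuous_cvg _ _ _ _ _ (fun z : X => z.2 - b) tb).
      by apply: continuous_time_barrier; case/andP: (in_t _ Cz).
    by apply: cvgB; [exact: cvg_snd|exact: cvg_cst].
  - by move=> z Cz; rewrite mulr_ge0 ?(ltW B0)// W0.
  - move=> z Cz bd; apply: (le_trans (uMu _ (sub _ Cz))).
    case: bd => [zt|[i zi]].
      apply: (@le_trans _ _ (B * tb (z.2 - b))).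
        rewrite /tb /time_barrier zt; apply: big_barrier; rewrite /r'; lra.
      by rewrite ler_wpM2l ?(ltW B0)// tb_le.
    apply: (@le_trans _ _ (B * sb (z.1 ord0 i - x ord0 i))).
      have gap := gap_gt0 (in_s z i Cz).
      apply: big_barrier => //.
      rewrite -(real_normK (num_real (z.1 ord0 i - x ord0 i))) zi /r'; nra.
    by rewrite ler_wpM2l ?(ltW B0)// sb_le.
  - move=> z Cz zr zt eps eps0.
    pose e' := eps / (B * N.+1%:R).
    have e'0 : 0 < e' by rewrite divr_gt0// mulr_gt0.
    pose sg i := z.1 ord0 i - x ord0 i; pose ta := z.2 - b.
    have sgr i : `|sg i| < r by exact: in_s.
    have /andP[ta1 ta2] : - r < ta <= r by exact: in_t.
    have space i : \forall s \near 0^'+, s ^- 2 * (sb (sg i + s) + sb (sg i - s)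
        - 2 * sb (sg i)) <= space_barrier2 r n (sg i) + e'.
      have nr : \forall y \near sg i, `|y| < r.
        have cn : {for sg i, continuous (fun y : R => `|y|)} by exact: norm_continuous.
        exact: (cn _ (lt_nbhsl (sgr i))).
      apply: (@second_difference_near _ _ (space_barrier1 r n)) => //.
      + by near=> y; apply: is_derive_space_barrier; near: y.
      + by near=> y; apply: is_derive_space_barrier1; near: y.
      + exact: continuous_space_barrier2.
    have time : \forall s \near 0^'+, - (s^-1 * (tb ta - tb (ta - s))) <=
        - (- (n%:R * time_barrier r n.+1 ta)) + e'.
      apply: (@first_difference_near _ tb (fun s => - (n%:R * time_barrier r n.+1 s))) => //.
      + near=> y; apply: is_derive_time_barrier; near: y; exact: lt_nbhsr.
      + apply: cvgN; apply: cvgM; first exact: cvg_cst.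
        exact: continuous_time_barrier.
    near=> s.
    rewrite heatqZ /W (heatq_separable (fun i y => sb (y - x ord0 i)) (fun y => tb (y - b))).
    have hW : \sum_(i < N) (space_barrier2 r n (sg i) + e') +
        (n%:R * time_barrier r n.+1 ta + e') <= Kc * N.+1%:R * W z `^ p + N.+1%:R * e'.
      have hp y : 0 <= y -> y <= W z -> Kc * y `^ p <= Kc * W z `^ p.
        move=> y0 yW; rewrite ler_wpM2l ?(ltW Kc0)//.
        by rewrite ge0_ler_powR ?nnegrE ?W0//; lra.
      rewrite -natr1 [Kc * _]mulrDr !mulrDl mulr1 mul1r addrACA lerD//.
        apply: (@le_trans _ _ (\sum_(i < N) (Kc * W z `^ p + e'))); last first.
          by rewrite sumr_const card_ord -[_ *+ N]mulr_natr; rewrite le_eqVlt; apply/orP; left; apply/eqP; ring.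
        apply: ler_sum => i _; rewrite lerD2r.
        apply: (le_trans (space_barrier2_le (sgr i) _ np)); first lra.
        by apply: hp; [rewrite ltW// sb0|exact: sb_le].
      rewrite lerD2r; apply: (le_trans (time_barrier1_le ta1 ta2 r12 np)).
      by apply: hp; [rewrite ltW// tb0|exact: tb_le].
    apply: (@le_trans _ _ (B * (Kc * N.+1%:R * W z `^ p + N.+1%:R * e'))).
      rewrite ler_wpM2l ?(ltW B0)//; apply: le_trans hW; apply: lerD.
        apply: ler_sum => i _.
        have -> : z.1 ord0 i + s - x ord0 i = sg i + s by rewrite /sg; ring.
        have -> : z.1 ord0 i - s - x ord0 i = sg i - s by rewrite /sg; ring.
        by move: i; near: s; exact: filter_forall.
      have -> : z.2 - s - b = ta - s by rewrite /ta; ring.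
      by rewrite -[X in X + e']opprK; near: s.
    rewrite powRM ?(ltW B0) ?W0// mulrDr [c * _]mulrA -BE lerD//.
      by rewrite le_eqVlt; apply/orP; left; apply/eqP; ring.
    rewrite mulrA /e' mulrCA divff ?mulr1// gt_eqF// mulr_gt0//.
have Cz1 : cylinder x r' (b - r') (b + r') z1.
  split=> [i|].
    by apply: (le_trans (norm_coordB z1 z0 i)); rewrite (le_trans (ltW z1r)).
  have := norm_timeB z1 z0; rewrite -/b ler_norml => /andP[? ?].
  by apply/andP; split; lra.
apply: (le_trans (uW _ Cz1)); rewrite ler_wpM2l ?(ltW B0)//.
have hr : `|r / 2| < r by rewrite gtr0_norm ?divr_gt0//; lra.
apply: lerD.
  apply: ler_sum => i _; rewrite ler_pXn2r ?nnegrE ?invr_ge0 ?(ltW (gap_gt0 _))//; last exact: in_s.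
  rewrite lef_pV2 ?posrE ?gap_gt0//; last exact: in_s.
  rewrite lerD2l lerN2 -(real_normK (num_real (_ - _))) lerXn2r ?nnegrE//; first lra.
  by rewrite (le_trans (norm_coordB z1 z0 i)) ?ltW.
have := norm_timeB z1 z0; rewrite -/b ler_norml => /andP[? ?].
rewrite ler_pXn2r ?nnegrE ?invr_ge0//; try lra.
by rewrite lef_pV2 ?posrE; lra.
Unshelve. all: by end_near. Qed.

End keller_osserman.

(** * The limit of the solutions and the geometry of the curve *)

Section large_solution.
Context {R : realType} {N : nat}.
Local Notation X := ('rV[R]_N * R)%type.

Section limit.
Context (T p : R) (h : X -> R) (u : R -> X -> R).
Hypothesis u_incr : forall k l z, 0 < k -> k <= l -> (QTbar T `\ 0) z -> u k z <= u l z.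

Lemma u_infty_sup z : (QTbar T `\ 0) z ->
  u_infty u z = ereal_sup (range (fun k => (u (Num.max 1 k) z)%:E)).
Proof.
move=> Qz; apply/cvg_lim => //.
have nd : nondecreasing_fun (fun k => (u (Num.max 1 k) z)%:E).
  move=> k l kl; rewrite lee_fin; apply: u_incr => //.
    by rewrite lt_max ltr01.
  by rewrite ge_max !le_max lexx kl orbT.
have := nondecreasing_cvge nd; apply: cvg_trans; apply: near_eq_cvg.
near=> k; rewrite max_r//; near: k; exact: nbhs_pinfty_ge.
Unshelve. all: by end_near. Qed.

Lemma u_infty_ge k z : 0 < k -> (QTbar T `\ 0) z -> ((u k z)%:E <= u_infty u z)%E.
Proof.
move=> k0 Qz; rewrite u_infty_sup//.
apply: (@le_trans _ _ (u (Num.max 1 k) z)%:E).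
  by rewrite lee_fin; apply: u_incr => //; rewrite le_max lexx orbT.
by apply: ereal_sup_ubound; exists k.
Qed.

Lemma u_infty_le (M : R) z : (QTbar T `\ 0) z ->
  (forall k, 0 < k -> u k z <= M) -> (u_infty u z <= M%:E)%E.
Proof.
move=> Qz uM; rewrite u_infty_sup//; apply: ge_ereal_sup => _ [k _ <-].
by rewrite lee_fin uM// lt_max ltr01.
Qed.

End limit.

Lemma QT_sub T : (QT T : set X) `<=` QTbar T `\ 0.
Proof.
move=> z /andP[z0 zT]; split; first by rewrite /QTbar/= !ltW.
by move=> z00; move: z0; rewrite z00 ltxx.
Qed.

Lemma limf_esup_pinfty (f : X -> \bar R) (D : set X) (z : X) :
  (forall (A : set X) (M : R), nbhs z A ->
    ~ (forall y, A y -> D y -> (f y <= M%:E)%E)) ->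
  limf_esup f (within D (nbhs z)) = +oo%E.
Proof.
move=> fz; apply/eqP; rewrite -leye_eq limf_esupE.
apply: le_ereal_inf_tmp => _ [V VD <-]; rewrite leye_eq; apply/eqP.
have ubV y : V y -> (f y <= ereal_sup (f @` V))%E.
  by move=> Vy; apply: ereal_sup_ubound; exists y.
case E : (ereal_sup (f @` V)) ubV => [r| |] // ubV; exfalso.
  by apply: (fz _ r VD) => y Vy Dy; exact/ubV/Vy.
apply: (fz _ 0 VD) => y Vy Dy; apply: (le_trans (ubV _ (Vy Dy))).
exact: leNye.
Qed.

(** The near-covering form of compactness, used along the filter of
    neighbourhoods of +oo, selects a finite cover and the largest of its bounds at
    once. *)
Lemma compact_bounded_family (I : Type) (P : set I) (u : I -> X -> R) (K : set X) :
  compact K ->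
  (forall y, K y -> exists2 d : R, 0 < d & exists M : R, forall k, P k ->
    forall z, `|z - y| < d -> u k z <= M) ->
  exists M : R, forall k, P k -> forall z, K z -> u k z <= M.
Proof.
move=> /compact_near_coveringP cK ub.
have nc : forall y, K y -> \forall z \near y & M \near +oo%R,
    forall k, P k -> u k z <= M.
  move=> y /ub[d d0 [M uM]].
  exists ([set z | `|z - y| < d], [set M' | M <= M']) => /=.
    split; last by apply: nbhs_pinfty_ge; exact: num_real.
    by apply/nbhs_normX; exists d.
  by move=> [z M'] /= [zy MM'] k Pk; apply: (le_trans (uM k Pk z zy)).
have H := cK _ _ _ _ nc.
near (pinfty_nbhs R) => M; exists M => k Pk z Kz.
suff : K `<=` [set z | forall k, P k -> u k z <= M] by move=> /(_ z Kz); exact.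
by near: M; exact: H.
Unshelve. all: by end_near. Qed.

Section curve.
Context (T : R) (gamma dgamma : R -> X).
Hypothesis gamma_lip : [lipschitz gamma tau | tau in `[0, T]].

Lemma curve_lipschitz : exists2 L : R, 0 < L & forall a b, a \in `[0, T] ->
  b \in `[0, T] -> `|gamma a - gamma b| <= L * `|a - b|.
Proof.
have [M [_ ML]] := gamma_lip.
exists (Num.max 1 (M + 1)); first by rewrite lt_max ltr01.
move=> a b a0 b0; apply: (ML _ _ (a, b)) => //.
by rewrite lt_max; apply/orP; right; rewrite ltrDl.
Qed.

(** Hence the curve meets each time slice at one point at most. *)
Lemma curve_time_increasing : C1_with 0 T gamma dgamma ->
  (forall tau, tau \in `]0, T] -> 0 < (dgamma tau).2) ->
  forall a b, 0 <= a -> a < b -> b <= T -> (gamma a).2 < (gamma b).2.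
Proof.
move=> [_ dg] dg0 a b a0 ab bT.
have [L L0 gL] := curve_lipschitz.
have dt s : s \in `]a, b[ -> is_derive (s : R) 1 (fun r => (gamma r).2) (dgamma s).2.
  rewrite in_itv/= => /andP[sa sb].
  have s0T : s \in `[0, T] by rewrite in_itv/=; apply/andP; split; lra.
  apply: is_derive_cvg.
  (* At interior points the difference quotients within [0, T] are ordinary ones. *)
  have h1 : (fun h : R => h *: 1 + s) @ 0^' --> within `[0, T] (s^').
    move=> A [e /= e0 eA].
    pose d := Num.min e (Num.min (s - a) (b - s)).
    have d0 : 0 < d by rewrite !lt_min e0 !subr_gt0 sa sb.
    exists d => //= y; rewrite /ball/= sub0r normrN => yd y0.
    have : `|y| < e /\ `|y| < s - a /\ `|y| < b - s.
      by move: yd; rewrite !lt_min => /andP[-> /andP[-> ->]].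
    rewrite !ltr_norml => -[/andP[? ?] [/andP[? ?] /andP[? ?]]].
    have yE : y *: (1 : R) + s = y + s by rewrite /GRing.scale/= mulr1.
    rewrite yE; apply: eA.
    - by rewrite /ball/= ltr_norml; apply/andP; split; lra.
    - by apply/eqP => ys; move/eqP: y0; apply; lra.
    - by rewrite /= in_itv/=; apply/andP; split; lra.
  have h2 := cvg_comp _ _ h1 (dg s s0T).
  have h3 : (fun z : X => z.2) @ dgamma s --> (dgamma s).2 by exact: cvg_snd.
  have h4 := cvg_comp _ _ h2 h3.
  rewrite (_ : (fun h => _) = (fun z : X => z.2) \o ((fun r => (r - s)^-1 *:
    (gamma r - gamma s)) \o (fun h : R => h *: 1 + s))); first exact: h4.
  by apply/funext => y; rewrite /= addrK /GRing.scale/= mulr1.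
have ct : {within `[a, b], continuous (fun r => (gamma r).2)}.
  apply/subspace_continuousP => s; rewrite /= in_itv/= => /andP[sa sb].
  apply/cvgrPdist_le => eps eps0; near=> r.
  have rab : r \in `[a, b] by near: r; exact: withinT.
  move: rab; rewrite in_itv/= => /andP[ra rb].
  apply: (le_trans (norm_timeB _ _)).
  apply: (le_trans (gL _ _ _ _)).
  - by rewrite in_itv/=; apply/andP; split; lra.
  - by rewrite in_itv/=; apply/andP; split; lra.
  rewrite mulrC -ler_pdivlMr//.
  near: r; apply: cvg_within; apply/nbhs_ballP.
  by exists (eps / L) => /=; [rewrite divr_gt0|move=> y /ltW].
have [c cab] := MVT ab dt ct.
have c0 : 0 < (dgamma c).2.
  by apply: dg0; move: cab; rewrite !in_itv/= => /andP[? ?]; apply/andP; split; lra.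
by move=> H; rewrite -subr_gt0 H mulr_gt0// subr_gt0.
Unshelve. all: by end_near. Qed.

End curve.

End large_solution.

(** * The dichotomy *)

Section constant_barrier.
Context {R : realType} {N : nat}.

Lemma heatq_cst (M s : R) (z : 'rV[R]_N * R) : heatq s (fun=> M) z = 0.
Proof.
rewrite /heatq subrr mulr0 subr0 big1// => i _.
by rewrite (_ : M + M - 2 * M = 0) ?mulr0//; ring.
Qed.

End constant_barrier.

Theorem theoremA (R : realType) (N : nat) (T p : R)
    (gamma dgamma : R -> 'rV[R]_N * R)
    (h : 'rV[R]_N * R -> R) (u : R -> 'rV[R]_N * R -> R)
    (N_ge1 : (1 <= N)%N) (T_gt0 : 0 < T) (p_gt1 : 1 < p)
    (gamma_range : forall tau, tau \in `[0, T] -> QTbar T (gamma tau))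
    (gamma_lip : [lipschitz gamma tau | tau in `[0, T]])
    (gamma_inj : {in `[0, T] &, injective gamma})
    (gamma_0 : gamma 0 = 0)
    (gamma_t_gt0 : forall tau, tau \in `]0, T] -> 0 < (gamma tau).2)
    (h_cont : {within QTbar T, continuous h})
    (h_eq0 : forall z, (gamma @` `[0, T]) z -> h z = 0)
    (h_gt0 : forall z, (QTbar T `\` gamma @` `[0, T]) z -> 0 < h z)
    (h_heat : forall r : R, 0 < r ->
      (\int[lebesgue_measure]_(t in `]0%R, T[)
         \int[lebesgue_rV N]_(x in [set x | (l2norm x < r)%R])
           (h (x, t) * heat_kernel (x, t) `^ p)%:E < +oo)%E)
    (u_sol : forall k, 0 < k -> is_unique_solution T p h k (u k))
    (u_incr : forall k l z, 0 < k -> k <= l -> (QTbar T `\ 0) z ->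
      u k z <= u l z)
    (gamma_C1 : C1_with 0 T gamma dgamma)
    (gamma_t'_gt0 : forall tau, tau \in `]0, T] -> 0 < (dgamma tau).2) :
  (forall z, QT T z -> (u_infty u z < +oo)%E) \/
  (exists2 tau0, tau0 \in `]0, T] &
     forall z, (gamma @` `[0, T]) z -> 0 <= z.2 <= tau0 ->
       limf_esup (u_infty u) (within (QT T) (nbhs z)) = +oo%E).
Proof.
have [fin|/existsNP[z0 /not_implyP[Qz0 z0oo]]] :=
  pselect (forall z, QT T z -> (u_infty u z < +oo)%E); [by left|right].
have [L L0 gL] := curve_lipschitz gamma_lip.
have inc := curve_time_increasing gamma_lip gamma_C1 gamma_t'_gt0.
have h_ge0 z : QT T z -> 0 <= h z.
  move=> /QT_sub[Qz _].
  have [Gz|Gz] := pselect ((gamma @` `[0, T]) z); first by rewrite h_eq0.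
  by rewrite ltW// h_gt0.
have sol k : 0 < k -> is_solution T p h k (u k) by move=> /u_sol[].
have norm_gamma tau : tau \in `[0, T] -> `|gamma tau| <= L * tau.
  move=> t0T; have t0 : (0 : R) \in `[0, T] by rewrite in_itv/= lexx ltW.
  have := gL _ _ t0T t0; rewrite gamma_0 !subr0 [in X in _ <= X]ger0_norm//.
  by move: t0T; rewrite in_itv/= => /andP[].
have /andP[t00 t0T] := Qz0.
set t0 := z0.2 in t00 t0T.
have off_curve y : QT T y -> ~ (gamma @` `[0, T]) y ->
    exists2 d : R, 0 < d & exists M : R, forall k, 0 < k ->
      forall z, `|z - y| < d -> u k z <= M.
  move=> Qy Gy.
  have hy : 0 < h y by apply: h_gt0; split => //; exact: (QT_sub Qy).1.
  have hy2 : 0 < h y / 2 by rewrite divr_gt0.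
  have hc : {for y, continuous h}.
    apply: (within_nbhs_continuous h_cont); apply: filterS (QT_nbhs Qy).
    by move=> z /QT_sub[].
  move/cvgrPdist_le : hc => /(_ _ hy2)/nbhs_normX[r r0 hr].
  have [|d d0 [M uM]] := keller_osserman p_gt1 Qy r0 hy2 (h := h).
    by move=> z _ /hr; rewrite ler_norml => /andP[? ?]; lra.
  by exists d => //; exists M => k k0; exact: (uM k (u k) (sol k k0)).
(* Otherwise the solutions are uniformly bounded on the parabolic boundary of a
   large cylinder that starts at the time of gamma tau and contains z0, because
   this boundary meets the curve at gamma tau only. *)
have blowup tau : tau \in `]0, T] -> (gamma tau).2 <= t0 / 2 ->
    forall (A : set ('rV[R]_N * R)) (M : R), nbhs (gamma tau) A ->
    ~ (forall y, A y -> QT T y -> (u_infty u y <= M%:E)%E).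
  move=> tau0T gt A M nA AM.
  have g0 := gamma_t_gt0 _ tau0T.
  have tau_T : tau \in `[0, T].
    by move: tau0T; rewrite !in_itv/= => /andP[/ltW -> ->].
  have Qg : QT T (gamma tau) by apply/andP; split; lra.
  set t1 := (gamma tau).2 in g0 gt.
  pose r := L * T + `|z0| + 1.
  have r0 : 0 < r by rewrite ltr_wpDl// addr_ge0// mulr_ge0// ltW.
  have gamma_r s : s \in `[0, T] -> `|(gamma s).1| < r.
    move=> s0T; have /andP[? ?] : 0 <= s <= T by move: s0T; rewrite in_itv.
    have : `|(gamma s).1| <= `|gamma s| by rewrite prod_normE le_max lexx.
    have := norm_gamma s s0T; have : L * s <= L * T by rewrite ler_wpM2l// ltW.
    have := normr_ge0 z0; rewrite /r; lra.
  have on_curve : exists2 d : R, 0 < d & exists M : R, forall k, 0 < k ->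
      forall z, `|z - gamma tau| < d -> u k z <= M.
    have /nbhs_normX[d d0 dA] : nbhs (gamma tau) (A `&` QT T).
      by apply: filterI => //; exact: QT_nbhs.
    exists d => //; exists M => k k0 z /dA[Az Qz].
    by rewrite -lee_fin (le_trans (u_infty_ge u_incr k0 (QT_sub Qz)))// AM.
  have [M1 uM1] : exists M : R, forall k, 0 < k ->
      forall z, cylinder (0 : 'rV[R]_N) r t1 t1 z -> u k z <= M.
    apply: (compact_bounded_family (P := fun k : R => 0 < k)).
      exact: cylinder_compact.
    move=> y [_]; rewrite -eq_le => /eqP t1y.
    have Qy : QT T y by rewrite /QT/= -t1y.
    have [[s /= s0T sy]|] := pselect ((gamma @` `[0, T]) y); last exact: off_curve.
    suff <- : gamma tau = y by [].
    rewrite -sy; congr gamma.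
    have /andP[? ?] : 0 <= s <= T by move: s0T; rewrite in_itv.
    have /andP[? ?] : 0 <= tau <= T by move: tau_T; rewrite in_itv.
    have st : (gamma s).2 = (gamma tau).2 by rewrite sy -t1y.
    apply/eqP; rewrite eq_le !leNgt; apply/andP; split; apply/negP => ts.
      have : (gamma s).2 < (gamma tau).2 by exact: inc.
      by rewrite st ltxx.
    have : (gamma tau).2 < (gamma s).2 by exact: inc.
    by rewrite st ltxx.
  have [M2 uM2] : exists M : R, forall k, 0 < k -> forall z,
      (cylinder (0 : 'rV[R]_N) r t1 t0 `&` [set z | r <= `|z.1|]) z -> u k z <= M.
    apply: (compact_bounded_family (P := fun k : R => 0 < k)).
      apply: compact_closedI; first exact: cylinder_compact.
      apply: (@closed_comp _ _ (fun z : 'rV[R]_N * R => `|z.1|) [set x | r <= x]).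
        move=> z _; apply: (@cvg_comp _ _ _ fst (fun x : 'rV[R]_N => `|x|)).
          exact: cvg_fst.
        exact: norm_continuous.
      exact: closed_ge.
    move=> y [[_ /andP[y1 y2]] /= ry].
    apply: off_curve; first by apply/andP; split; lra.
    by move=> [s /= s0T sy]; have := gamma_r s s0T; rewrite sy ltNge ry.
  pose M' := Num.max 0 (Num.max M1 M2).
  have M'0 : 0 <= M' by rewrite le_max lexx.
  apply: z0oo; apply: (@le_lt_trans _ _ M'%:E); last exact: ltry.
  apply: (u_infty_le u_incr (QT_sub Qz0)) => k k0.
  apply: (@comparison_principle R N T p h k (u k) 0 r t1 t0 0 (fun=> M') 1) => //.
  - lra.
  - exact: sol.
  - by move=> _ z' _ Qz' _; exact: h_ge0.
  - by apply: continuous_subspaceT => z; exact: cvg_cst.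
  - move=> z Cz [zt|[i zi]].
      have : u k z <= M1.
        by apply: uM1 => //; split; [exact: Cz.1|rewrite zt lexx].
      by move=> h1; rewrite !le_max h1 orbT.
    have : u k z <= M2.
      by apply: uM2 => //; split => //=; rewrite -zi mxE subr0 norm_coord.
    by move=> h1; rewrite !le_max h1 !orbT.
  - move=> z _ _ _ eps eps0; near=> s.
    by rewrite heatq_cst mul0r add0r ltW.
  - split; last by apply/andP; split; [lra|].
    move=> i; rewrite mxE subr0 (le_trans (norm_coord _ _))//.
    have : `|z0.1| <= `|z0| by rewrite prod_normE le_max lexx.
    have : 0 <= L * T by rewrite mulr_ge0// ltW.
    rewrite /r; lra.
exists (t0 / 2); first by rewrite in_itv/=; apply/andP; split; lra.
move=> z [tau /= tau0T <-] /andP[_ gt]; apply: limf_esup_pinfty => A M nA.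
have [tau0|tau_gt0] := leP tau 0; last first.
  apply: blowup nA => //; rewrite in_itv/= tau_gt0.
  by move: tau0T; rewrite in_itv/= => /andP[].
(* The origin is a limit of points of the curve at positive times, and each of its
   neighbourhoods is a neighbourhood of such a point. *)
have {tau0 gt} : gamma tau = 0.
  have -> : tau = 0 by apply/eqP; rewrite eq_le tau0; move: tau0T; rewrite in_itv/= => /andP[].
  by [].
move=> g0; move: nA; rewrite g0 => /nbhs_normX[d d0 dA].
pose s := Num.min T (Num.min (d / (2 * L)) (t0 / (2 * L))).
have s0 : 0 < s by rewrite !lt_min T_gt0 !divr_gt0// mulr_gt0.
have [sT sd st] : [/\ s <= T, s <= d / (2 * L) & s <= t0 / (2 * L)].
  by rewrite /s !ge_min !lexx !orbT.
have L2 : 0 < 2 * L by rewrite mulr_gt0.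
move: sd st; rewrite !ler_pdivlMr// => sd st.
have s0T : s \in `[0, T] by rewrite in_itv/= sT ltW.
have gs := norm_gamma s s0T.
apply: (blowup s).
- by rewrite in_itv/= s0.
- have := norm_timeB (gamma s) 0; rewrite !subr0 => h1.
  have := ler_norm (gamma s).2; lra.
- apply/nbhs_normX; exists (d / 2); first by rewrite divr_gt0.
  move=> y yd; apply: dA; rewrite subr0.
  have -> : y = (y - gamma s) + gamma s by rewrite subrK.
  apply: (le_lt_trans (ler_normD _ _)); lra.
Unshelve. all: by end_near. Qed.
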